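(* Let $b\ge2$, $d\ge1$, $t\ge0$ be fixed integers, and let $(P_{b^m})_{m\ge t}$ be a family of deterministic $(t,m,d)$-nets in base $b$, not necessarily digital. Put $N=b^m$. Assume that the family satisfies the uniform coincidence bound with constant $A\ge1$ and the uniform common-prefix cutoff with parameter $\kappa\in\mathbb N_0$. If $\widetilde P_{b^m}$ is obtained from $P_{b^m}$ by full Owen scrambling, then, as $m\to\infty$, $$ R_\infty(\widetilde P_{b^m})=\Omega_{\mathbb P}\left(N^{-3/(2d)}(\log N)^{-(d-1)/(2d)}\right), \qquad R_\infty(\widetilde P_{b^m})=O_{\mathbb P}\left(N^{-3/(2d)}\right), $$ $$ h_\infty(\widetilde P_{b^m})\asymp_{b,d,t}N^{-1/d}, $$ and $$ \rho_\infty(\widetilde P_{b^m})=\Omega_{\mathbb P}\left(N^{1/(2d)}\right), \qquad \rho_\infty(\widetilde P_{b^m})=O_{\mathbb P}\left(N^{1/(2d)}(\log N)^{(d-1)/(2d)}\right). $$ Here $\asymp_{b,d,t}$ means two-sided bounds with positive constants depending only on $b,d,t$.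
   Context: For $\boldsymbol k\in\mathbb N_0^d$, let $\mathcal E_{\boldsymbol k}$ be the collection of level-$\boldsymbol k$ elementary intervals $\prod_{j=1}^d[a_jb^{-k_j},(a_j+1)b^{-k_j})$, $0\le a_j<b^{k_j}$, and $|\boldsymbol k|=k_1+\dots+k_d$; each has volume $b^{-|\boldsymbol k|}$. For $0\le t\le m$, a $(t,m,d)$-net in base $b$ is a $b^m$-point multiset in $[0,1)^d$ such that every elementary interval of volume $b^{t-m}$ contains exactly $b^t$ of its points. For an $N$-point multiset $P_{b^m}=(\boldsymbol x_n)_{0\le n<N}$, $N=b^m$, let $\nu_m(E)=\#\{n:\boldsymbol x_n\in E\}$ and $M_m(\boldsymbol k)=\sum_{E\in\mathcal E_{\boldsymbol k}}\nu_m(E)(\nu_m(E)-1)$. (For digital points, membership is determined by the specified output-digit expansion.) - Uniform coincidence bound with constant $A\ge1$: $M_m(\boldsymbol k)\le AN(N-1)b^{-|\boldsymbol k|}$ for all $\boldsymbol k\in\mathbb N_0^d$, with the same $A$ for every $m$. - Uniform common-prefix cutoff with parameter $\kappa\in\mathbb N_0$: for every $m$, every $E\in\mathcal E_{\boldsymbol k}$ with $|\boldsymbol k|\ge m+\kappa$ contains at most one point of $P_{b^m}$, counted with multiplicity, with the same $\kappa$ for every $m$. Full Owen scrambling in base $b$: independently for each coordinate $j$ and each finite digit prefix $a_1\cdots a_{r-1}\in\{0,\dots,b-1\}^{r-1}$ ($r\ge1$), choose a uniform random permutation $\pi_{j,a_1\cdots a_{r-1}}$ of $\{0,\dots,b-1\}$,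 all mutually independent. The $j$-th coordinate of every point, with base-$b$ digits $(a_r)_{r\ge1}$ (regular expansion, not ending in infinitely many digits $b-1$; for digital points, the specified output digits), is replaced by the number with digits $\widetilde a_r=\pi_{j,a_1\cdots a_{r-1}}(a_r)$. For an $N$-point multiset $P=(\boldsymbol x_n)_{0\le n<N}$ in $[0,1]^d$ with $N\ge2$: $R_\infty(P)=\min_{n<n'}\|\boldsymbol x_n-\boldsymbol x_{n'}\|_\infty$, $h_\infty(P)=\sup_{\boldsymbol z\in[0,1]^d}\min_{n}\|\boldsymbol z-\boldsymbol x_n\|_\infty$, $\rho_\infty(P)=2h_\infty(P)/R_\infty(P)$ ($=\infty$ if $R_\infty(P)=0$). Probabilistic order: $X_m=O_{\mathbb P}(a_m)$ means that for every $\varepsilon>0$ there are $C_\varepsilon>0$ and $m_\varepsilon$ with $\mathbb P(|X_m|>C_\varepsilon a_m)\le\varepsilon$ for all $m\ge m_\varepsilon$; for positive $X_m$, $X_m=\Omega_{\mathbb P}(a_m)$ means $a_m/X_m=O_{\mathbb P}(1)$. *)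

(* Defs.v *)
From HB Require Import structures.
From mathcomp Require Import all_boot all_order all_fingroup all_algebra.
From mathcomp Require Import all_classical all_reals all_analysis.

Set Implicit Arguments.
Unset Strict Implicit.
Unset Printing Implicit Defensive.

Import Order.TTheory GRing.Theory Num.Theory numFieldNormedType.Exports.

Local Open Scope classical_set_scope.
Local Open Scope ring_scope.

(* Digit positions are counted from 0: the digit [a r] has weight b^-(r+1).   *)
Definition digit_value (R : realType) (b : nat) (a : nat -> 'I_b) : R :=
  limn (series (fun r => (a r)%:R / b%:R ^+ r.+1 : R)).

Definition regular_expansion (R : realType) (b : nat) (x : R)
    (a : nat -> 'I_b) : Prop :=
  digit_value R a = x /\
  ~ (exists r0, forall r, (r0 <= r)%N -> a r = b.-1 :> nat).

(* A coordinate of a point is either an ordinary real number of [0, 1),       *)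
(* together with its (unique) regular base-b expansion, or an output-digit    *)
(* sequence specified by a digital construction, which is allowed to end in   *)
(* infinitely many digits b - 1.                                              *)
Variant coordinate (R : realType) (b : nat) : Type :=
| RealCoord (x : R) (a : nat -> 'I_b) of 0 <= x < 1 & regular_expansion x a
| DigitalCoord (a : nat -> 'I_b).
Arguments DigitalCoord R {b} a.

Definition digits (R : realType) (b : nat) (c : coordinate R b) : nat -> 'I_b :=
  match c with RealCoord _ a _ _ => a | DigitalCoord a => a end.

(* [coord_in c k a]: c belongs to the interval [a b^-k, (a+1) b^-k); for      *)
(* specified digits this means that the first k digits are those of a.        *)
Definition coord_in (R : realType) (b : nat) (c : coordinate R b) (k a : nat) :
    bool :=
  match c with
  | RealCoord x _ _ _ => a%:R / b%:R ^+ k <= x < a.+1%:R / b%:R ^+ k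
  | DigitalCoord s => (\sum_(r < k) s r * b ^ (k - r.+1))%N == a
  end.

Definition point_set (R : realType) (b d N : nat) : Type :=
  'I_N -> 'I_d -> coordinate R b.

(* An elementary interval of level k is given by its numerators a.            *)
Definition elem_interval (b d : nat) (k : 'I_d -> nat) : finType :=
  {dffun forall j : 'I_d, 'I_(b ^ k j)}.

Definition count_in (R : realType) (b d N : nat) (P : point_set R b d N)
    (k : 'I_d -> nat) (a : elem_interval b k) : nat :=
  #|[set n : 'I_N | [forall j : 'I_d, coord_in (P n j) (k j) (a j)]]|.

Definition coincidences (R : realType) (b d N : nat) (P : point_set R b d N)
    (k : 'I_d -> nat) : nat :=
  (\sum_(a : elem_interval b k) count_in P a * (count_in P a - 1))%N.

(* A level-k interval has volume b^(t-m) iff |k| = m - t.                     *)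
Definition is_net (R : realType) (b d t m : nat)
    (P : point_set R b d (b ^ m)) : Prop :=
  (t <= m)%N /\
  forall k : 'I_d -> nat, (\sum_(j < d) k j + t)%N = m ->
  forall a : elem_interval b k, count_in P a = (b ^ t)%N.

Definition coincidence_bound (R : realType) (b d t : nat) (A : R)
    (P : forall m : nat, point_set R b d (b ^ m)) : Prop :=
  forall m, (t <= m)%N -> forall k : 'I_d -> nat,
    (coincidences (P m) k)%:R <=
      A * (b ^ m)%:R * ((b ^ m)%:R - 1) / b%:R ^+ (\sum_(j < d) k j)%N.

Definition prefix_cutoff (R : realType) (b d t kappa : nat)
    (P : forall m : nat, point_set R b d (b ^ m)) : Prop :=
  forall m, (t <= m)%N -> forall k : 'I_d -> nat,
    (m + kappa <= \sum_(j < d) k j)%N ->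
    forall a : elem_interval b k, (count_in (P m) a <= 1)%N.

Definition mutually_independent (R : realType) (disp : measure_display)
    (T : measurableType disp) (Pr : probability T R)
    (I : eqType) (S : finType) (X : T -> I -> S) : Prop :=
  forall (s : seq I) (B : I -> {set S}), uniq s ->
    Pr [set w | forall i, i \in s -> X w i \in B i] =
    (\prod_(i <- s) Pr [set w | X w i \in B i])%E.

(* The permutation attached to coordinate j and digit prefix p is [pi w (j, p)]. *)
Definition owen_permutations (R : realType) (disp : measure_display)
    (T : measurableType disp) (Pr : probability T R) (b d : nat)
    (pi : T -> 'I_d * seq 'I_b -> {perm 'I_b}) : Prop :=
  [/\ forall i s, measurable [set w | pi w i = s],
      forall i s, Pr [set w | pi w i = s] = ((b`!)%:R^-1)%:E
    & mutually_independent Pr pi].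

Definition scrambled_digits (b d : nat)
    (pi : 'I_d * seq 'I_b -> {perm 'I_b}) (j : 'I_d) (a : nat -> 'I_b) :
    nat -> 'I_b :=
  fun r => pi (j, mkseq a r) (a r).

Definition scramble (R : realType) (b d N : nat)
    (pi : 'I_d * seq 'I_b -> {perm 'I_b}) (P : point_set R b d N) :
    'I_N -> 'rV[R]_d :=
  fun n => \row_j digit_value R (scrambled_digits pi j (digits (P n j))).

(* On 'rV[R]_d the norm `|x| is the maximum norm.                             *)
Definition R_infty (R : realType) (d N : nat) (x : 'I_N -> 'rV[R]_d) : \bar R :=
  \big[mine/+oo%E]_(p : 'I_N * 'I_N | (p.1 < p.2)%N) (`|x p.1 - x p.2|)%:E.

Definition h_infty (R : realType) (d N : nat) (x : 'I_N -> 'rV[R]_d) : \bar R :=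
  ereal_sup [set \big[mine/+oo%E]_(n < N) (`|z - x n|)%:E
            | z in [set z : 'rV[R]_d | forall j, 0 <= z ord0 j <= 1]].

Definition rho_infty (R : realType) (d N : nat) (x : 'I_N -> 'rV[R]_d) :
    \bar R :=
  if R_infty x == 0%E then +oo%E else (2%:E * h_infty x / R_infty x)%E.

(* The m-th variable may live on its own probability space.                   *)
Definition bigO_P (R : realType) (disp : nat -> measure_display)
    (T : forall m, measurableType (disp m))
    (Pr : forall m, probability (T m) R)
    (X : forall m, T m -> \bar R) (a : nat -> R) : Prop :=
  forall eps : R, 0 < eps ->
  exists C : R, 0 < C /\
  exists m0 : nat, forall m, (m0 <= m)%N ->
    (Pr m [set w | (C * a m)%:E < `|X m w|] <= eps%:E)%E.

(* In \bar R the inverse of 0 is +oo and that of +oo is 0.                    *)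
Definition bigOmega_P (R : realType) (disp : nat -> measure_display)
    (T : forall m, measurableType (disp m))
    (Pr : forall m, probability (T m) R)
    (X : forall m, T m -> \bar R) (a : nat -> R) : Prop :=
  bigO_P Pr (fun m w => ((a m)%:E / X m w)%E) (fun=> 1).

(* Main.v *)
Require Import Defs.
From HB Require Import structures.
From mathcomp Require Import all_boot all_order all_fingroup all_algebra.
From mathcomp Require Import all_classical all_reals all_analysis.
From mathcomp Require Import measurable_realfun.
From mathcomp Require Import zify ring lra.

Set Implicit Arguments.
Unset Strict Implicit.
Unset Printing Implicit Defensive.

Import Order.TTheory GRing.Theory Num.Theory numFieldNormedType.Exports.

Local Open Scope classical_set_scope.
Local Open Scope ring_scope.

(** Scrambling acts on digit prefixes, and permutes the elementary intervals of
    each level.  So, for every outcome, each interval of volume b^(t-m) still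
    meets the closure of the scrambled net, which bounds h from above
    ([scramble_h_infty_le]); a pigeonhole on a grid with more than N nodes bounds
    it from below ([h_infty_ge]).  Thus h has order N^(-1/d) surely, and the two
    statements on rho = 2h/R follow from those on R.

    Lower bound on R.  Let two points share exactly k_j digits in coordinate j.
    For their scrambled versions to come within b^-r in that coordinate, the
    larger one must continue with digits 0 and the smaller one with digits b-1
    from just after the split up to position r, that is, 2(r-k_j-1) independent
    uniform digits take prescribed values.  A pair is therefore that close with
    probability at most the product over j of 2 b^(-2(r-k_j-1))
    ([close_configs_prob]).  The coincidence bound counts the pairs sharing a
    prefix vector k, the cutoff restricts k to |k| < m + kappa, and the sum of
    b^|k| over these k is at most (m+kappa)^(d-1) b^(m+kappa)
    ([sum_levels_le]), whence an expected number of close pairs of order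
    N^3 (log N)^(d-1) b^(-2rd) ([R_infty_small_prob]).

    Upper bound on R.  Take cubes of level k, with dk just below m - t.  Each
    contains two points of the net ([net_pair]), which become neighbours at level
    r with probability at least b^(-2(r-k)) per coordinate ([adjacent_prob]).  In
    a coordinate where two cubes differ, their events concern disjoint sets of
    permutations; in a coordinate where they agree, the joint probability is at
    most that of one of them.  The second moment of the number of such events,
    each weighted by the inverse of its probability ([second_moment]), then
    factors over the coordinates ([sum_collisions]): the probability that no pair
    becomes close is at most (1 + (b^(2(r-k))-1) b^-k)^d - 1
    ([R_infty_large_prob]), which is small as soon as b^r is a small multiple of
    N^(3/(2d)).

    Both estimates are computed in the finite uniform space of the permutations
    attached to prefixes of length at most r ([prob_config]).  The events of the
    theorem involve all digits; they are measurable because R and h are Lipschitz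
    functions of the points, hence limits of functions of finitely many digits
    ([measurable_scramble]). *)

(** * Digit sequences and their values *)

Definition prefix_num (b : nat) (s : nat -> 'I_b) (k : nat) : nat :=
  (\sum_(r < k) s r * b ^ (k - r.+1))%N.

Lemma prefix_num0 b (s : nat -> 'I_b) : prefix_num s 0 = 0%N.
Proof. by rewrite /prefix_num big_ord0. Qed.

Lemma prefix_numS b (s : nat -> 'I_b) k :
  prefix_num s k.+1 = (b * prefix_num s k + s k)%N.
Proof.
rewrite /prefix_num big_ord_recr /= subnn expn0 muln1; congr addn.
rewrite big_distrr /=; apply: eq_bigr => i _.
by rewrite subSn ?ltn_ord // expnS mulnCA.
Qed.

Lemma prefix_num_lt b (s : nat -> 'I_b) k : (prefix_num s k < b ^ k)%N.
Proof.
elim: k => [|k IH]; first by rewrite prefix_num0.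
have := ltn_ord (s k); rewrite prefix_numS expnS; nia.
Qed.

Lemma prefix_num_eq b (s s' : nat -> 'I_b) k :
  (forall i, (i < k)%N -> s i = s' i) -> prefix_num s k = prefix_num s' k.
Proof. by move=> h; apply: eq_bigr => i _; rewrite h. Qed.

Lemma prefix_num_inj b (s s' : nat -> 'I_b) k :
  prefix_num s k = prefix_num s' k -> forall i, (i < k)%N -> s i = s' i.
Proof.
elim: k => // k IH; rewrite !prefix_numS => E i.
have b0 : (0 < b)%N by apply: leq_ltn_trans (ltn_ord (s 0%N)).
have E1 : prefix_num s k = prefix_num s' k.
  have := congr1 (divn^~ b) E.
  by rewrite /= !(mulnC b) !divnMDl // !divn_small ?ltn_ord // !addn0.
rewrite ltnS leq_eqVlt => /orP[/eqP ->|]; last exact: IH.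
by apply/val_inj/eqP; rewrite -(eqn_add2l (b * prefix_num s k)) {2}E1 E.
Qed.

Lemma prefix_num_surj b k e : (0 < b)%N -> (e < b ^ k)%N ->
  exists s : nat -> 'I_b, prefix_num s k = e.
Proof.
move=> b0; elim: k e => [|k IH] e.
  rewrite expn0 ltnS leqn0 => /eqP ->.
  by exists (fun=> Ordinal b0); rewrite prefix_num0.
rewrite expnSr -ltn_divLR // => /IH[s Es].
pose s' i := if i == k then Ordinal (ltn_pmod e b0) else s i.
exists s'; rewrite prefix_numS [s' k]/s' eqxx /= [RHS](divn_eq e b) mulnC.
congr (_ * _ + _)%N; rewrite -Es; apply: prefix_num_eq => i ik.
by rewrite /s' ltn_eqF.
Qed.

Lemma prefix_num_fork_le b (s s' : nat -> 'I_b) l r : (l < r)%N ->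
  (forall i, (i < l)%N -> s i = s' i) -> (s' l < s l)%N ->
  (prefix_num s' r < prefix_num s r)%N.
Proof.
move=> lr hl hlt; elim: r lr => // r IH; rewrite ltnS leq_eqVlt => /orP[/eqP<-|].
  by rewrite !prefix_numS (prefix_num_eq hl) ltn_add2l.
by move/IH; rewrite !prefix_numS; have := ltn_ord (s' r); nia.
Qed.

(** Once [s] is ahead of [s'] at position [l], the gap between the prefix
    numbers is multiplied by [b] at each step and corrected by a digit
    difference of at least [1 - b]; it stays equal to 1 only if that difference
    is always extreme. *)
Lemma prefix_num_adjacent b (s s' : nat -> 'I_b) l r : (l < r)%N ->
  (forall i, (i < l)%N -> s i = s' i) -> (s' l < s l)%N ->
  (prefix_num s r <= (prefix_num s' r).+1)%N ->
  forall i, (l < i < r)%N -> s i = 0 :> nat /\ s' i = b.-1 :> nat.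
Proof.
move=> lr hl hlt; elim: r lr => // r IH _ hle i /andP[li].
rewrite ltnS => ir; have {}lr : (l < r)%N by apply: leq_trans li ir.
have lt := prefix_num_fork_le lr hl hlt.
move: hle; rewrite !prefix_numS => hle.
have h1 := ltn_ord (s r); have h2 := ltn_ord (s' r).
have h3 : (prefix_num s r <= (prefix_num s' r).+1)%N by nia.
have h4 : prefix_num s r = (prefix_num s' r).+1 by lia.
move: ir; rewrite leq_eqVlt => /orP[/eqP->|ir]; last by apply: IH => //; rewrite li.
by move: hle; rewrite h4; split; nia.
Qed.

Lemma prefix_num_fork b (s s' : nat -> 'I_b) l r : (l < r)%N ->
  (forall i, (i < l)%N -> s i = s' i) -> s l = (s' l).+1 :> nat ->
  (forall i, (l < i < r)%N -> s i = 0 :> nat /\ s' i = b.-1 :> nat) ->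
  prefix_num s r = (prefix_num s' r).+1.
Proof.
move=> + hl hlt; elim: r => // r IH; rewrite ltnS leq_eqVlt => /orP[/eqP<-|lr] h.
  by rewrite !prefix_numS (prefix_num_eq hl) hlt addnS.
have [e e'] : s r = 0 :> nat /\ s' r = b.-1 :> nat by apply: h; rewrite lr /=.
rewrite !prefix_numS e e' IH //; last by move=> i /andP[? ?]; apply: h; lia.
by have := ltn_ord (s' r); nia.
Qed.

Section value.
Context {R : realType} {b : nat}.
Implicit Types (s : nat -> 'I_b).

Let term s : R^nat := fun r => (s r)%:R / b%:R ^+ r.+1.

Lemma base_gt0 s : (0 < b%:R :> R).
Proof. by rewrite ltr0n; apply: leq_ltn_trans (ltn_ord (s 0%N)). Qed.

Lemma series_prefix_num s k :
  series (fun r => (s r)%:R / b%:R ^+ r.+1 : R) k = (prefix_num s k)%:R / b%:R ^+ k.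
Proof.
have b0 : (b%:R != 0 :> R) by rewrite gt_eqF // (base_gt0 s).
rewrite /series /=; elim: k => [|k IH]; first by rewrite big_geq // prefix_num0 mul0r.
rewrite big_nat_recr //= IH prefix_numS natrD natrM mulrDl; congr +%R.
by rewrite exprS -mulf_div divff // mul1r.
Qed.

Lemma prefix_num_antitone s k n : (k <= n)%N ->
  ((prefix_num s n)%:R + 1) / b%:R ^+ n <= ((prefix_num s k)%:R + 1) / b%:R ^+ k :> R.
Proof.
have b0 := base_gt0 s.
move=> kn; rewrite -(subnK kn); elim: (n - k)%N => // i IH.
apply: le_trans IH; rewrite addSn prefix_numS ler_pdivrMr ?exprn_gt0 //.
rewrite exprS mulrA mulrAC divfK ?gt_eqF ?exprn_gt0 //.
rewrite !natr1 -natrM ler_nat; have := ltn_ord (s (i + k)%N); nia.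
Qed.

Lemma digit_value_cvg s :
  cvgn (series (fun r => (s r)%:R / b%:R ^+ r.+1 : R)).
Proof.
have b0 := base_gt0 s.
apply: nondecreasing_is_cvgn.
  apply/nondecreasing_seqP => n.
  by rewrite /series /= big_nat_recr //= lerDl divr_ge0 // exprn_ge0 // ltW.
exists 1 => _ [n _ <-]; rewrite series_prefix_num ler_pdivrMr ?exprn_gt0 // mul1r.
by rewrite -natrX ler_nat ltnW // prefix_num_lt.
Qed.

Lemma digit_value_ge s k : (prefix_num s k)%:R / b%:R ^+ k <= digit_value R s.
Proof.
rewrite -series_prefix_num; apply: nondecreasing_cvgn_le; last exact: digit_value_cvg.
have b0 := base_gt0 s; apply/nondecreasing_seqP => n.
by rewrite /series /= big_nat_recr //= lerDl divr_ge0 // exprn_ge0 // ltW.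
Qed.

Lemma digit_value_le s k :
  digit_value R s <= ((prefix_num s k)%:R + 1) / b%:R ^+ k.
Proof.
have b0 := base_gt0 s.
apply: limr_le; first exact: digit_value_cvg.
exists k => // n /= kn; rewrite series_prefix_num.
apply: le_trans (prefix_num_antitone s kn).
by rewrite ler_pM2r ?invr_gt0 ?exprn_gt0 // lerDl.
Qed.

Lemma digit_value_lt s k :
  ~ (exists r0, forall r, (r0 <= r)%N -> s r = b.-1 :> nat) ->
  digit_value R s < ((prefix_num s k)%:R + 1) / b%:R ^+ k.
Proof.
have b0 := base_gt0 s.
move=> reg; rewrite lt_neqAle digit_value_le andbT; apply/eqP => E; apply: reg.
exists k => n kn; apply/eqP; apply: contraT => nE.
have := digit_value_le s n.+1; rewrite E leNgt => /negP[].
apply: lt_le_trans (prefix_num_antitone s kn).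
rewrite ltr_pdivrMr ?exprn_gt0 // exprS mulrA mulrAC divfK ?gt_eqF ?exprn_gt0 //.
rewrite prefix_numS !natr1 -natrM ltr_nat; have := ltn_ord (s n); nia.
Qed.

(** A regular expansion has value strictly below the right end of each of its
    prefix intervals, so that half-open intervals and prefixes select the same
    points, as they do by definition for specified digits. *)
Lemma coord_inE (c : coordinate R b) k a :
  coord_in c k a = (prefix_num (digits c) k == a).
Proof.
case: c => [x s x01 [xE reg]|s] //=; have b0 := base_gt0 s.
have bk : 0 < b%:R ^+ k :> R by rewrite exprn_gt0.
have h1 := digit_value_ge s k; have h2 := digit_value_lt k reg.
rewrite -xE ler_pdivrMr // ltr_pdivlMr //.
move: h1 h2; rewrite ler_pdivrMr // ltr_pdivlMr // => h1 h2.
apply/andP/eqP => [[h3 h4]|<-]; last by rewrite -[_.+1]addn1 natrD.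
have h5 := le_lt_trans h1 h4; have h6 := le_lt_trans h3 h2.
move: h5 h6; rewrite -[1]/(1%:R) -natrD !ltr_nat; lia.
Qed.

Lemma digit_value_dist s s' k e : (prefix_num s k <= prefix_num s' k + e)%N ->
  (prefix_num s' k <= prefix_num s k + e)%N ->
  `|digit_value R s - digit_value R s'| <= e.+1%:R / b%:R ^+ k.
Proof.
move=> h h'; have b0 := base_gt0 s.
have := digit_value_ge s k; have := digit_value_le s k.
have := digit_value_ge s' k; have := digit_value_le s' k.
have bk : 0 < b%:R ^+ k :> R by rewrite exprn_gt0.
rewrite ler_norml !ler_pdivrMr // !ler_pdivlMr // -mulNr ler_pdivrMr //.
move: h h'; rewrite -!(ler_nat R) !natrD -natr1 mulrBl => h h' h1 h2 h3 h4; lra.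
Qed.

(** A value may be the right end of its prefix interval, so a difference below
    one interval length still allows the next larger interval, but no further
    one. *)
Lemma digit_value_close s s' k :
  digit_value R s - digit_value R s' < b%:R ^- k ->
  (prefix_num s k <= (prefix_num s' k).+1)%N.
Proof.
have b0 := base_gt0 s.
have := digit_value_ge s k; have := digit_value_le s' k.
have bk : 0 < b%:R ^+ k :> R by rewrite exprn_gt0.
rewrite !ler_pdivrMr // !ler_pdivlMr // -div1r ltr_pdivlMr // mulrBl => h1 h2 h3.
rewrite -ltnS -(ltr_nat R) -!natr1; lra.
Qed.

End value.

(** * The covering radius *)

Lemma rV_norm_leP (R : realType) d (v : 'rV[R]_d) c : 0 <= c ->
  reflect (forall j, `|v ord0 j| <= c) (`|v| <= c).
Proof.
move=> c0; rewrite [`|v|]/Num.norm /= mx_normrE.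
apply: (iffP (bigmax_leP _ _ _ _)) => [[_ h] j|h]; first exact: (h (ord0, j)).
by split => // -[i j] _ /=; rewrite (ord1 i).
Qed.

Lemma rV_coord_le (R : realType) d (v : 'rV[R]_d) j : `|v ord0 j| <= `|v|.
Proof. exact: (rV_norm_leP v (normr_ge0 _) (lexx _)). Qed.

Lemma h_infty_le (R : realType) d N (x : 'I_N -> 'rV[R]_d) c : 0 <= c ->
  (forall z : 'rV[R]_d, (forall j, 0 <= z ord0 j <= 1) ->
     exists n, forall j, `|z ord0 j - x n ord0 j| <= c) ->
  (h_infty x <= c%:E)%E.
Proof.
move=> c0 h; apply: ge_ereal_sup => _ [z z01 <-].
have [n hn] := h z z01; apply: (@bigmin_inf _ _ _ _ n) => //.
by rewrite lee_fin; apply/rV_norm_leP => // j; rewrite !mxE.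
Qed.

(** Among more than [N] grid nodes at mutual distance at least [1/q], two would
    have the same nearest point if all were within less than [1/(2q)]. *)
Lemma h_infty_ge (R : realType) d N q (x : 'I_N -> 'rV[R]_d) :
  (0 < q)%N -> (N < q ^ d)%N -> (((2 * q%:R)^-1)%:E <= h_infty x)%E.
Proof.
move=> q0 Nq; rewrite leNgt; apply/negP => hlt.
have qR : 0 < q%:R :> R by rewrite ltr0n.
pose z (i : {ffun 'I_d -> 'I_q}) : 'rV[R]_d := \row_j ((i j)%:R / q%:R).
have near i : exists n, `|z i - x n| < (2 * q%:R)^-1.
  have : (\big[mine/+oo%E]_(n < N) (`|z i - x n|)%:E < ((2 * q%:R)^-1)%:E)%E.
    apply: le_lt_trans hlt; apply: ereal_sup_ubound; exists (z i) => // j.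
    rewrite mxE divr_ge0 //= ler_pdivrMr // mul1r ler_nat ltnW //.
  by move=> /bigmin_ltP[//|[n _]]; rewrite lte_fin; exists n.
pose f i := xchoose (near i).
have : ~~ injectiveb f.
  apply/negP => /injectiveP /leq_card.
  by rewrite card_ffun !card_ord leqNgt Nq.
move=> /injectivePn[i [i' ne ff]].
have h1 := xchooseP (near i); have h2 := xchooseP (near i').
rewrite -/(f i') -ff in h2.
have [j nej] : exists j, i j != i' j.
  by apply/existsP; apply: contraR ne; rewrite negb_exists => /forallP h;
    apply/eqP/ffunP => j; apply/eqP; move: (h j); rewrite negbK.
have h3 : `|(i j)%:R / q%:R - (i' j)%:R / q%:R : R| < q%:R^-1.
  have -> : (i j)%:R / q%:R - (i' j)%:R / q%:R = (z i - z i') ord0 j :> R.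
    by rewrite !mxE.
  apply: le_lt_trans (rV_coord_le _ _) _.
  have -> : z i - z i' = (z i - x (f i)) - (z i' - x (f i)).
    by rewrite opprB addrA subrK.
  apply: le_lt_trans (ler_normB _ _) _.
  have -> : q%:R^-1 = (2 * q%:R)^-1 + (2 * q%:R)^-1 :> R by field; rewrite gt_eqF.
  exact: ltrD.
move: h3; rewrite -mulrBl normrM [`|q%:R^-1|]ger0_norm ?invr_ge0 ?ler0n //.
rewrite -[ltRHS]mul1r ltr_pM2r ?invr_gt0 // ltNge => /negP[].
case: (ltngtP (i j) (i' j)) => [l|l|/val_inj E]; last by rewrite E eqxx in nej.
  by rewrite distrC -natrB 1?ltnW // ger0_norm // ler1n subn_gt0.
by rewrite -natrB 1?ltnW // ger0_norm // ler1n subn_gt0.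
Qed.

Lemma scrambled_digits_eq b d (pi : 'I_d * seq 'I_b -> {perm 'I_b}) j s s' l :
  (forall i, (i < l)%N -> s i = s' i) ->
  forall i, (i < l)%N -> scrambled_digits pi j s i = scrambled_digits pi j s' i.
Proof.
move=> h i il; rewrite /scrambled_digits h //; congr (pi (j, _) _).
apply/eq_in_map => k; rewrite mem_iota => /andP[_ ki].
by apply: h; apply: ltn_trans il.
Qed.

(** Scrambling permutes the prefixes of each length: the inverse permutations
    are applied digit by digit, each at the prefix already recovered. *)
Lemma scrambled_digits_surj b d (pi : 'I_d * seq 'I_b -> {perm 'I_b}) j v k :
  exists s, forall i, (i < k)%N -> scrambled_digits pi j s i = v i.
Proof.
elim: k => [|k [s IH]]; first by exists v.
pose s' i := if i == k then (pi (j, mkseq s k))^-1%g (v k) else s i.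
have h i : (i < k)%N -> s' i = s i by move=> ik; rewrite /s' ltn_eqF.
exists s' => i; rewrite ltnS leq_eqVlt => /orP[/eqP->|ik]; last first.
  by rewrite (scrambled_digits_eq _ _ h) // IH.
rewrite /scrambled_digits {2}/s' eqxx.
have -> : mkseq s' k = mkseq s k.
  by apply/eq_in_map => r; rewrite mem_iota => /andP[_]; exact: h.
by rewrite permKV.
Qed.

(** A level coarser than that of the net property is refined in the first
    coordinate until its intervals have volume [b^(t-m)]. *)
Lemma net_hit (R : realType) b d t m (P : point_set R b d (b ^ m)) (k : 'I_d -> nat)
    (v : 'I_d -> nat -> 'I_b) : (0 < b)%N -> (0 < d)%N ->
  is_net t P -> (\sum_(j < d) k j + t <= m)%N ->
  exists n, forall j i, (i < k j)%N -> digits (P n j) i = v j i.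
Proof.
move=> b0 d0 [tm net] km; pose j0 := Ordinal d0.
pose k' j := (k j + (if j == j0 then m - (\sum_(j < d) k j + t) else 0))%N.
have k'm : (\sum_(j < d) k' j + t)%N = m.
  by rewrite big_split /= -big_mkcond big_pred1_eq addnAC subnKC.
pose a : elem_interval b k' := [ffun j => Ordinal (prefix_num_lt (v j) (k' j))].
have : (0 < count_in P a)%N by rewrite net // expn_gt0 b0.
move=> /card_gt0P[n]; rewrite inE => /forallP h.
exists n => j i ik; apply: (@prefix_num_inj _ _ _ (k' j)).
  by have := h j; rewrite coord_inE ffunE /= => /eqP.
exact: leq_trans ik (leq_addr _ _).
Qed.

(** The endpoint [z = 1] belongs to no half-open interval and is assigned to
    the last one. *)
Lemma unit_interval_cell (R : realType) b k (z : R) : (0 < b)%N -> 0 <= z <= 1 ->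
  exists v : nat -> 'I_b, forall s, (forall i, (i < k)%N -> s i = v i) ->
    `|z - digit_value R s| <= b%:R ^- k.
Proof.
move=> b0 /andP[z0 z1].
have bk : 0 < b%:R ^+ k :> R by rewrite exprn_gt0 // ltr0n.
have bN : (0 < b ^ k)%N by rewrite expn_gt0 b0.
have [e [eb h1 h2]] : exists e, [/\ (e < b ^ k)%N, e%:R <= z * b%:R ^+ k
    & z * b%:R ^+ k <= e%:R + 1 :> R].
  have [zl|zg] := ltP z 1; last first.
    have -> : z = 1 by apply/le_anti; rewrite z1.
    exists (b ^ k).-1; rewrite mul1r -natrX natr1 prednK // ler_nat leq_pred.
    by split=> //; rewrite prednK.
  have zk0 : 0 <= z * b%:R ^+ k by rewrite mulr_ge0 // ltW.
  exists (Num.trunc (z * b%:R ^+ k)).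
  have /andP[h1 h2] := truncn_itv zk0.
  split=> //; last by rewrite natr1 ltW.
  rewrite -(ltr_nat R); apply: le_lt_trans h1 _.
  by rewrite natrX gtr_pMl.
have [v vE] := prefix_num_surj b0 eb.
exists v => s /prefix_num_eq sv.
have := @digit_value_ge R _ s k; have := @digit_value_le R _ s k.
rewrite sv vE ler_pdivrMr // ler_pdivlMr // => h3 h4.
rewrite ler_norml -div1r -mulNr ler_pdivrMr // ler_pdivlMr // mulrBl.
by apply/andP; split; lra.
Qed.

Lemma scramble_h_infty_le (R : realType) b d t m (P : point_set R b d (b ^ m))
    (pi : 'I_d * seq 'I_b -> {perm 'I_b}) : (0 < b)%N -> (0 < d)%N -> is_net t P ->
  (h_infty (scramble pi P) <= (b%:R ^- ((m - t) %/ d))%:E)%E.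
Proof.
move=> b0 d0 net; have bR : 1 <= b%:R :> R by rewrite ler1n.
have bk k : 0 < b%:R ^+ k :> R by rewrite exprn_gt0 // ltr0n.
apply: h_infty_le => [|z z01]; first by rewrite invr_ge0 ltW.
have /choice[v hv] j := unit_interval_cell ((m - t) %/ d) b0 (z01 j).
have /choice[u hu] j := scrambled_digits_surj pi j (v j) ((m - t) %/ d).
have [|n hn] := net_hit u b0 d0 net (k := fun=> ((m - t) %/ d)%N).
  rewrite sum_nat_const card_ord mulnC; case: net => tm _.
  by rewrite -[leqRHS](subnK tm) leq_add2r leq_trunc_div.
exists n => j; rewrite mxE; apply: le_trans (hv j _ _) _.
  move=> i ik; rewrite -hu //.
  exact: (scrambled_digits_eq _ _ (hn j)).
exact: lexx.
Qed.

(** * Measurability and the law of finitely many permutations *)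

Lemma R_infty_ge0 (R : realType) d N (x : 'I_N -> 'rV[R]_d) : (0 <= R_infty x)%E.
Proof. by apply: le_bigmin => // p _; rewrite lee_fin. Qed.

Lemma h_infty_ge0 (R : realType) d N (x : 'I_N -> 'rV[R]_d) : (0 <= h_infty x)%E.
Proof.
apply: le_trans (ereal_sup_ubound _).
  2: by exists 0 => // j; rewrite mxE lexx ler01.
by apply: le_bigmin => // p _; rewrite lee_fin.
Qed.

Lemma R_infty_fin_num (R : realType) d N (x : 'I_N -> 'rV[R]_d) : (1 < N)%N ->
  R_infty x \is a fin_num.
Proof.
move=> N1; rewrite ge0_fin_numE ?R_infty_ge0 //.
have N0 : (0 < N)%N by apply: ltnW.
pose p := (Ordinal N0, Ordinal N1).
apply: (@le_lt_trans _ _ (`|x p.1 - x p.2|)%:E); last exact: ltry.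
exact: (bigmin_inf (p)).
Qed.

Lemma h_infty_fin_num (R : realType) d N (x : 'I_N -> 'rV[R]_d) : (0 < N)%N ->
  h_infty x \is a fin_num.
Proof.
move=> N0; rewrite ge0_fin_numE ?h_infty_ge0 //.
apply: (@le_lt_trans _ _ (1 + `|x (Ordinal N0)|)%:E); last exact: ltry.
apply: ge_ereal_sup => _ [z z01 <-]; apply: (bigmin_inf (Ordinal N0)) => //.
rewrite lee_fin; apply: le_trans (ler_normB _ _) _; rewrite lerD2r.
by apply/rV_norm_leP => // j; have /andP[z0 z1] := z01 j; rewrite ger0_norm.
Qed.

Lemma R_infty_lipschitz (R : realType) d N (x y : 'I_N -> 'rV[R]_d) delta :
  (forall n, `|x n - y n| <= delta) -> (R_infty x <= R_infty y + (2 * delta)%:E)%E.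
Proof.
move=> xy; rewrite -leeBlDr //; apply/bigmin_geP; split=> [|p lp]; first exact: leey.
rewrite leeBlDr //; apply: (bigmin_inf (p)) => //; rewrite lee_fin.
have -> : x p.1 - x p.2 = (y p.1 - y p.2) + ((x p.1 - y p.1) - (x p.2 - y p.2)).
  by apply/rowP => j; rewrite !mxE; ring.
apply: le_trans (ler_normD _ _) _; rewrite lerD2l mulr_natl mulr2n.
by apply: le_trans (ler_normB _ _) _; apply: lerD.
Qed.

Lemma h_infty_lipschitz (R : realType) d N (x y : 'I_N -> 'rV[R]_d) delta :
  (forall n, `|x n - y n| <= delta) -> (h_infty x <= h_infty y + delta%:E)%E.
Proof.
move=> xy; apply: ge_ereal_sup => _ [z z01 <-].
rewrite -leeBlDr //; apply: le_trans (ereal_sup_ubound _).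
  2: by exists z; [exact: z01|reflexivity].
apply/bigmin_geP; split=> [|n _]; first exact: leey.
rewrite leeBlDr //; apply: (bigmin_inf (n)) => //; rewrite lee_fin.
have -> : z - x n = (z - y n) - (x n - y n) by apply/rowP => j; rewrite !mxE; ring.
by apply: le_trans (ler_normB _ _) _; rewrite lerD2l.
Qed.

Definition config (b d r : nat) : finType :=
  {ffun 'I_d * r.-bseq 'I_b -> {perm 'I_b}}.

Definition config_of b d r (pi : 'I_d * seq 'I_b -> {perm 'I_b}) : config b d r :=
  [ffun i : 'I_d * r.-bseq 'I_b => pi (i.1, i.2 : seq 'I_b)].

(** Beyond prefixes of length [r] the values are those at the empty prefix; only
    the first [r] digits of a scrambled sequence are meant to be used. *)
Definition perms_of b d r (f : config b d r) : 'I_d * seq 'I_b -> {perm 'I_b} :=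
  fun i => f (i.1, insub_bseq r i.2).

Lemma perms_of_config_of b d r (pi : 'I_d * seq 'I_b -> {perm 'I_b}) j p :
  (size p <= r)%N -> perms_of (config_of r pi) (j, p) = pi (j, p).
Proof.
by move=> pr; rewrite /perms_of /config_of ffunE /= /insub_bseq insubdK.
Qed.

Lemma scrambled_digits_config b d r (pi : 'I_d * seq 'I_b -> {perm 'I_b}) j s i :
  (i < r)%N ->
  scrambled_digits (perms_of (config_of r pi)) j s i = scrambled_digits pi j s i.
Proof.
by move=> ir; rewrite /scrambled_digits perms_of_config_of // size_mkseq ltnW.
Qed.

Section law.
Context (R : realType) (disp : measure_display) (T : measurableType disp)
  (Pr : probability T R) (b d : nat) (pi : T -> 'I_d * seq 'I_b -> {perm 'I_b})
  (owen : owen_permutations Pr pi).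

Lemma config_of_eq r w (f : config b d r) :
  (config_of r (pi w) = f) <->
  (forall i : 'I_d * r.-bseq 'I_b, pi w (i.1, i.2 : seq 'I_b) = f i).
Proof.
split=> [<- i|h]; first by rewrite ffunE.
by apply/ffunP => i; rewrite ffunE h.
Qed.

Lemma measurable_config1 r (f : config b d r) :
  measurable [set w | config_of r (pi w) = f].
Proof.
have [mpi _ _] := owen.
have -> : [set w | config_of r (pi w) = f] =
    \bigcap_(i in [set: 'I_d * r.-bseq 'I_b]) [set w | pi w (i.1, i.2 : seq
      'I_b) = f i].
  apply/seteqP; split=> w /=; first by move=> /config_of_eq h i _; apply: h.
  by move=> h; apply/config_of_eq => i; apply: h.
apply: fin_bigcap_measurable => [|i _]; last exact: mpi.
exact: finite_finset.
Qed.

Lemma prob_config1 r (f : config b d r) :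
  Pr [set w | config_of r (pi w) = f] = ((#|config b d r|%:R)^-1)%:E.
Proof.
have [_ upi ipi] := owen.
pose emb (i : 'I_d * r.-bseq 'I_b) := (i.1, i.2 : seq 'I_b).
have emb_inj : injective emb by move=> [j p] [j' p'] [-> /val_inj ->].
pose B x : {set {perm 'I_b}} := [set s | [forall i, (emb i == x) ==> (s == f i)]]%SET.
have BE i : B (emb i) = [set f i]%SET.
  apply/setP => s; rewrite !inE; apply/forallP/eqP => [/(_ i)|-> i'].
    by rewrite eqxx => /eqP.
  by apply/implyP => /eqP /emb_inj ->.
have -> : [set w | config_of r (pi w) = f] =
    [set w | forall x, x \in map emb (enum {: 'I_d * r.-bseq 'I_b}) -> pi w x \in B x].
  apply/seteqP; split=> w /=.
    by move=> /config_of_eq h x /mapP[i _ ->]; rewrite BE inE; apply/eqP/h.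
  move=> h; apply/config_of_eq => i; apply/eqP.
  by have := h (emb i); rewrite BE inE; apply; apply: map_f; rewrite mem_enum.
have us : uniq (map emb (enum {: 'I_d * r.-bseq 'I_b})).
  by rewrite map_inj_uniq ?enum_uniq.
rewrite (ipi _ _ us) big_map.
rewrite (eq_bigr (fun=> ((b`!)%:R^-1)%:E)); last first.
  move=> i _; rewrite BE -(upi (emb i) (f i)); congr (Pr _).
  by apply/seteqP; split => w /=; rewrite inE => /eqP.
rewrite prodEFin big_const_seq count_predT -cardE iter_mulr_1 exprVn -natrX.
by rewrite card_ffun /= card_Sn.
Qed.

Lemma config_eventE r (Q : {set config b d r}) :
  [set w | config_of r (pi w) \in Q] =
  \bigcup_(f in [set` enum Q]) [set w | config_of r (pi w) = f].
Proof.
apply/seteqP; split=> w /=; last by move=> [f /=]; rewrite mem_enum => + ->.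
by move=> h; exists (config_of r (pi w)) => //=; rewrite mem_enum.
Qed.

Lemma measurable_config r (Q : {set config b d r}) :
  measurable [set w | config_of r (pi w) \in Q].
Proof.
rewrite config_eventE; apply: fin_bigcup_measurable => // f _.
exact: measurable_config1.
Qed.

Lemma prob_config r (Q : {set config b d r}) :
  Pr [set w | config_of r (pi w) \in Q] = (#|Q|%:R / #|config b d r|%:R)%:E.
Proof.
rewrite config_eventE measure_fin_bigcup //; first last.
- by move=> f _; exact: measurable_config1.
- by move=> f g _ _ [w [/= -> ->]].
rewrite -fsbig_seq ?enum_uniq // (eq_bigr (fun=> ((#|config b d
  r|%:R)^-1)%:E)); last first.
  by move=> f _; apply: prob_config1.
by rewrite sumEFin big_const_seq count_predT -cardE iter_addr_0 mulr_natl.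
Qed.

Lemma scramble_config_dist r N (P : point_set R b d N) w n :
  `|scramble (perms_of (config_of r (pi w))) P n - scramble (pi w) P n| <= b%:R ^- r.
Proof.
apply/rV_norm_leP => [|j]; first by rewrite invr_ge0 exprn_ge0.
rewrite !mxE; have E : prefix_num
    (scrambled_digits (perms_of (config_of r (pi w))) j (digits (P n j))) r =
    prefix_num (scrambled_digits (pi w) j (digits (P n j))) r.
  by apply: prefix_num_eq => i ir; rewrite scrambled_digits_config.
by rewrite -div1r; apply: digit_value_dist (0%N) _ _; rewrite E addn0.
Qed.

(** Replacing the permutations beyond level [r] moves every point by at most
    [b^-r], so a Lipschitz functional of the scrambled points is a pointwise
    limit of functions of finitely many permutations. *)
Lemma measurable_scramble N (P : point_set R b d N) (L : R)
    (F : ('I_N -> 'rV[R]_d) -> R) : (1 < b)%N ->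
  (forall x y delta, (forall n, `|x n - y n| <= delta) -> F x <= F y + L * delta) ->
  measurable_fun setT (fun w => F (scramble (pi w) P)).
Proof.
move=> b1 Flip.
pose G r w := F (scramble (perms_of (config_of r (pi w))) P).
apply: (@measurable_fun_cvg _ _ _ _ G) => [r|w _].
  move=> _ Y mY; rewrite setTI.
  have -> : G r @^-1` Y = [set w | config_of r (pi w) \in
      [set f : config b d r | `[< Y (F (scramble (perms_of f) P)) >]]%SET].
    by apply/seteqP; split=> w /=; rewrite inE asboolE.
  exact: measurable_config.
have dist r : `|G r w - F (scramble (pi w) P)| <= L * b%:R ^- r.
  rewrite ler_distl lerBlDr; apply/andP; split; apply: Flip => n.
    by rewrite distrC scramble_config_dist.
  exact: scramble_config_dist.
have : (fun r => L * b%:R ^- r : R) @ \oo --> (0 : R).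
  rewrite -(mulr0 L); apply: cvgMr.
  under eq_fun do rewrite -exprVn.
  apply: cvg_expr; rewrite ger0_norm ?invr_ge0 ?ler0n //.
  by rewrite invf_lt1 ?ltr1n ?ltr0n // ltnW.
move=> lim0; apply/cvgrPdist_le => e e0.
have /cvgrPdist_le/(_ e e0) := lim0.
apply: filterS => r; rewrite sub0r normrN => h.
by rewrite distrC; apply: le_trans (dist r) _; apply: le_trans h; apply: ler_norm.
Qed.

End law.
Lemma measurable_lt_set (R : realType) (disp : measure_display) (T :
  measurableType disp)
    (f g : T -> R) : measurable_fun setT f -> measurable_fun setT g ->
  measurable [set w | f w < g w].
Proof.
have mt : measurable [set true] by [].
move=> mf mg; have := measurable_fun_ltr mf mg measurableT mt.
rewrite setTI; congr measurable; apply/seteqP; split=> w /=; by [].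
Qed.

Section extremal_measurability.
Context (R : realType) (disp : measure_display) (T : measurableType disp)
  (Pr : probability T R) (b d N : nat) (pi : T -> 'I_d * seq 'I_b -> {perm 'I_b})
  (P : point_set R b d N).
Context (owen : owen_permutations Pr pi) (b1 : (1 < b)%N) (N1 : (1 < N)%N).

Lemma measurable_R_infty :
  measurable_fun setT (fun w => fine (R_infty (scramble (pi w) P))).
Proof.
apply: (measurable_scramble owen P (L := 2) (F := fun x => fine (R_infty x)) b1).
move=> x y delta xy; have := R_infty_lipschitz xy.
by rewrite -{1}(fineK (R_infty_fin_num x N1)) -{1}(fineK (R_infty_fin_num y
  N1)) lee_fin.
Qed.

Lemma measurable_h_infty :
  measurable_fun setT (fun w => fine (h_infty (scramble (pi w) P))).
Proof.
have N0 := ltnW N1.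
apply: (measurable_scramble owen P (L := 1) (F := fun x => fine (h_infty x)) b1).
move=> x y delta xy; have := h_infty_lipschitz xy; rewrite mul1r.
by rewrite -{1}(fineK (h_infty_fin_num x N0)) -{1}(fineK (h_infty_fin_num y
  N0)) lee_fin.
Qed.

End extremal_measurability.

(** * Probabilities in a finite uniform space *)

Lemma union_bound (T I : finType) (Q : {set T}) (Y : I -> {set T}) (P : pred I) :
  (forall f, f \in Q -> exists2 i, P i & f \in Y i) ->
  (#|Q| <= \sum_(i | P i) #|Y i|)%N.
Proof.
move=> h; rewrite -sum1_card big_mkcond.
under [X in (_ <= X)%N]eq_bigr do rewrite -sum1_card big_mkcond.
rewrite exchange_big; apply: leq_sum => f _; case: ifP => // fQ.
by have [i Pi fi] := h f fQ; rewrite (bigD1 i) //= fi leq_addr.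
Qed.

(** Chebyshev for [X], the sum over [i] of the indicator of [Y i] divided by its
    probability: its mean is the number of indices, and it vanishes on [Q].
    The weights make the bound insensitive to how unequal the probabilities of
    the [Y i] are. *)
Lemma second_moment (R : realType) (T I : finType) (Y : I -> {set T})
    (Q : {set T}) (c : I -> I -> R) :
  let p (A : {set T}) : R := #|A|%:R / #|T|%:R in
  (0 < #|T|)%N -> (0 < #|I|)%N ->
  (forall i, 0 < p (Y i)) ->
  (forall i j, p (Y i :&: Y j)%SET <= p (Y i) * p (Y j) * c i j) ->
  (forall f i, f \in Q -> f \notin Y i) ->
  p Q <= (\sum_i \sum_j c i j) / #|I|%:R ^+ 2 - 1.
Proof.
move=> p T0 I0 p0 pc hQ.
have TR : 0 < #|T|%:R :> R by rewrite ltr0n.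
have MR : 0 < #|I|%:R :> R by rewrite ltr0n.
set M := #|I|%:R in MR *.
pose ind (A : {set T}) f : R := (f \in A)%:R.
have sum_ind A : \sum_f ind A f = p A * #|T|%:R.
  rewrite /p divfK ?gt_eqF // -sum1_card natr_sum [RHS]big_mkcond /=.
  by apply: eq_bigr => f _; rewrite /ind; case: (f \in A).
clearbody p; pose X f := \sum_i ind (Y i) f / p (Y i).
have EX : \sum_f X f = M * #|T|%:R.
  rewrite exchange_big /= (eq_bigr (fun=> #|T|%:R)) => [|i _].
    by rewrite sumr_const -[LHS]mulr_natl.
  by rewrite -mulr_suml sum_ind mulrAC divff ?mul1r // gt_eqF.
have EX2 : \sum_f X f ^+ 2 <= (\sum_i \sum_j c i j) * #|T|%:R.
  rewrite (eq_bigr (fun f => \sum_i \sum_j ind (Y i :&: Y j)%SET f / (p (Y i) *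
    p (Y j)))).
    rewrite exchange_big mulr_suml ler_sum // => i _.
    rewrite exchange_big mulr_suml ler_sum // => j _.
    have pp : 0 < p (Y i) * p (Y j) by apply: mulr_gt0.
    by rewrite -mulr_suml sum_ind ler_pdivrMr // [leRHS]mulrAC ler_pM2r // mulrC.
  move=> f _; rewrite expr2 mulr_suml; apply: eq_bigr => i _.
  rewrite mulr_sumr; apply: eq_bigr => j _.
  rewrite /ind inE invfM; case: (f \in Y i); case: (f \in Y j) => /=;
    by rewrite !(mul0r, mulr0, mul1r).
have EV : \sum_f (X f - M) ^+ 2 = \sum_f X f ^+ 2 - M ^+ 2 * #|T|%:R.
  under eq_bigr do rewrite sqrrB -mulr_natr.
  rewrite !big_split /= sumr_const sumrN -!mulr_suml EX -mulr_natr; ring.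
have : p Q * #|T|%:R * M ^+ 2 <= \sum_f (X f - M) ^+ 2.
  rewrite -sum_ind mulr_suml; apply: ler_sum => f _; rewrite /ind.
  case: (boolP (f \in Q)) => fQ; last by rewrite mul0r sqr_ge0.
  rewrite mul1r /X big1 ?sub0r ?sqrrN // => i _.
  by rewrite /ind (negbTE (hQ _ _ fQ)) mul0r.
rewrite EV => h; rewrite lerBrDr ler_pdivlMr ?exprn_gt0 //.
rewrite -(ler_pM2r TR); apply: le_trans EX2; move: h;
  rewrite -(lerD2r (M ^+ 2 * #|T|%:R)).
by rewrite subrK => h; apply: le_trans h; rewrite le_eqVlt;
  apply/orP/or_introl/eqP; ring.
Qed.

(** Composition with [g^-1] turns these permutations into those that fix [S]
    pointwise. *)
Lemma card_perm_prescribed b (S : {set 'I_b}) (g : {perm 'I_b}) :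
  #|[set s : {perm 'I_b} | [forall u in S, s u == g u]]%SET| = (b - #|S|)`!.
Proof.
have -> : [set s : {perm 'I_b} | [forall u in S, s u == g u]]%SET =
    [set (h * g)%g | h in [set s | perm_on (~: S) s]]%SET.
  apply/setP => s; rewrite inE; apply/forall_inP/imsetP => [h|[h hS ->] u uS].
    exists (s * g^-1)%g; last by rewrite mulgKV.
    rewrite inE; apply/fintype.subsetP => u; rewrite !inE permM; apply: contraNN => uS.
    by rewrite (eqP (h u uS)) permK.
  rewrite inE in hS; rewrite permM (out_perm hS) //.
  by rewrite inE uS.
rewrite card_imset; last exact: mulIg.
by rewrite cardsE card_perm cardsCs finset.setCK card_ord.
Qed.

Lemma card_perm1 b (u v : 'I_b) : (#|[set s : {perm 'I_b} | s u == v]%SET| * b = b`!)%N.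
Proof.
have -> : [set s : {perm 'I_b} | s u == v]%SET =
    [set s : {perm 'I_b} | [forall w in [set u]%SET, s w == (tperm u v) w]]%SET.
  apply/setP => s; rewrite !inE; apply/idP/forall_inP => [h w|/(_ u)].
    by rewrite inE => /eqP ->; rewrite tpermL.
  by rewrite inE eqxx tpermL => ->.
rewrite card_perm_prescribed cards1 mulnC.
by move: (leq_ltn_trans (leq0n u) (ltn_ord u)); clear; case: b => // n _; rewrite subn1.
Qed.

(** A product of two transpositions realizes the two prescribed values, so
    that [card_perm_prescribed] applies. *)
Lemma card_perm2 b (u v u' v' : 'I_b) : u != u' -> v != v' ->
  (#|[set s : {perm 'I_b} | (s u == v) && (s u' == v')]%SET| * (b * b.-1) = b`!)%N.
Proof.
move=> uu vv; pose w := tperm u v u'.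
have wv : w != v by rewrite /w -{2}(tpermL u v) (inj_eq perm_inj) eq_sym.
pose g := (tperm u v * tperm w v')%g.
have gu : g u = v by rewrite permM tpermL tpermD // eq_sym.
have gu' : g u' = v' by rewrite permM tpermL.
have -> : [set s : {perm 'I_b} | (s u == v) && (s u' == v')]%SET =
    [set s : {perm 'I_b} | [forall x in [set u; u']%SET, s x == g x]]%SET.
  apply/setP => s; rewrite !inE; apply/andP/forall_inP => [[h h'] x|h].
    by rewrite !inE => /orP[]/eqP->; rewrite ?gu ?gu'.
  have := h u; have := h u'; rewrite !inE !eqxx orbT gu gu' => h1 h2.
  by rewrite h1 ?h2.
rewrite card_perm_prescribed cards2 uu.
have : (1 < b)%N.
  by have := ltn_ord u; have := ltn_ord u'; move: uu; rewrite -val_eqE /=; lia.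
clear; case: b => [|[|n]] // _.
by rewrite /= subn2 /= mulnC -mulnA -factS -factS.
Qed.

(** Constraints on each permutation separately; independence makes the
    probability of such an event a product ([box_prob]). *)
Definition box b d r (B : 'I_d -> r.-bseq 'I_b -> {set {perm 'I_b}}) :
  {set config b d r} :=
  [set f : config b d r | [forall i : 'I_d * r.-bseq 'I_b, f i \in B i.1 i.2]]%SET.

Definition perm_prob (R : realType) b (S : {set {perm 'I_b}}) : R := #|S|%:R / (b`!)%:R.

Lemma perm_prob_ge0 (R : realType) b (S : {set {perm 'I_b}}) : 0 <= perm_prob R S.
Proof. by rewrite divr_ge0. Qed.

Lemma perm_probS (R : realType) b (S S' : {set {perm 'I_b}}) : S \subset S' ->
  perm_prob R S <= perm_prob R S'.
Proof. by move=> h; rewrite ler_pM2r ?invr_gt0 ?ltr0n ?fact_gt0 //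
  ler_nat subset_leq_card. Qed.

Lemma perm_probT (R : realType) b : perm_prob R [set: {perm 'I_b}]%SET = 1.
Proof. by rewrite /perm_prob cardsT card_Sn divff // pnatr_eq0 -lt0n fact_gt0. Qed.

Lemma perm_prob1 (R : realType) b (u v : 'I_b) :
  perm_prob R [set s : {perm 'I_b} | s u == v]%SET = b%:R^-1.
Proof.
have b0 : (0 < b)%N by apply: leq_ltn_trans (ltn_ord u).
rewrite /perm_prob -(card_perm1 u v) natrM invfM mulrA divff ?mul1r //.
apply: contraTneq (fact_gt0 b) => /eqP; rewrite pnatr_eq0 => /eqP E.
by rewrite -(card_perm1 u v) E.
Qed.

Lemma perm_prob2 (R : realType) b (u v u' v' : 'I_b) : u != u' -> v != v' ->
  b%:R ^- 2 <= perm_prob R [set s : {perm 'I_b} | (s u == v) && (s u' == v')]%SET.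
Proof.
move=> uu vv; have b0 : (0 < b)%N by apply: leq_ltn_trans (ltn_ord u).
have E := card_perm2 uu vv.
set S := [set s | _]%SET in E *.
rewrite /perm_prob -E -div1r ler_pdivrMr ?exprn_gt0 ?ltr0n // mulrAC.
rewrite ler_pdivlMr ?mul1r ?ltr0n ?E ?fact_gt0 // -natrX -natrM ler_nat -E.
by rewrite leq_mul2l expnS expn1 leq_mul2l leq_pred !orbT.
Qed.

Lemma box_prob (R : realType) b d r (B : 'I_d -> r.-bseq 'I_b -> {set {perm 'I_b}}) :
  #|box B|%:R / #|config b d r|%:R = \prod_j \prod_p perm_prob R (B j p) :> R.
Proof.
have -> : #|box B| = (\prod_j \prod_p #|B j p|)%N.
  rewrite pair_big_dep /=.
  have -> : #|box B| = #|family (fun i => mem (B i.1 i.2))|.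
    apply: eq_card => f; rewrite inE; apply/forallP/familyP => h i; exact: h.
  by rewrite card_family foldrE big_image.
have -> : #|config b d r| = (\prod_(j < d) \prod_(p : r.-bseq 'I_b) b`!)%N.
  by rewrite pair_big_dep /= card_ffun card_Sn prod_nat_const.
rewrite !natr_prod -prodf_div; apply: eq_bigr => j _.
by rewrite !natr_prod -prodf_div.
Qed.

Lemma boxI b d r (B B' : 'I_d -> r.-bseq 'I_b -> {set {perm 'I_b}}) :
  (box B :&: box B' = box (fun j p => B j p :&: B' j p))%SET.
Proof.
apply/setP => f; rewrite !inE; apply/andP/forallP => [[/forallP h /forallP h'] i|h].
  by rewrite inE h h'.
by split; apply/forallP => i; have := h i; rewrite inE => /andP[].
Qed.

(** * Pairs of sequences that scrambling makes neighbours *)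

Lemma mkseq_eqP (T : eqType) (x y : nat -> T) k :
  reflect (forall i, (i < k)%N -> x i = y i) (mkseq x k == mkseq y k).
Proof.
apply: (iffP eqP) => [E i ik|h].
  by rewrite -(nth_mkseq (x i) x ik) E nth_mkseq.
by apply/eq_in_map => i; rewrite mem_iota => /andP[_]; exact: h.
Qed.

Definition common_prefix (T : eqType) (x y : nat -> T) (r : nat) : nat :=
  find (fun i => x i != y i) (iota 0 r).

Lemma common_prefix_le (T : eqType) (x y : nat -> T) r : (common_prefix x y r <= r)%N.
Proof. by rewrite -[leqRHS](size_iota 0) find_size. Qed.

Lemma common_prefix_eq (T : eqType) (x y : nat -> T) r i :
  (i < common_prefix x y r)%N -> x i = y i.
Proof.
move=> h; have := before_find 0%N h; rewrite nth_iota ?add0n => [/negbFE/eqP //|].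
exact: leq_trans h (common_prefix_le _ _ _).
Qed.

Lemma common_prefix_neq (T : eqType) (x y : nat -> T) r : (common_prefix x y r < r)%N ->
  x (common_prefix x y r) != y (common_prefix x y r).
Proof.
move=> h; have : has (fun i => x i != y i) (iota 0 r) by rewrite has_find size_iota.
by move=> /(nth_find 0%N); rewrite nth_iota.
Qed.

Definition on_path (T : eqType) (x : nat -> T) (p : seq T) : bool :=
  p == mkseq x (size p).

Lemma on_path_mkseq (T : eqType) (x : nat -> T) i : on_path x (mkseq x i).
Proof. by rewrite /on_path size_mkseq. Qed.

Lemma on_path_eq (T : eqType) (x y : nat -> T) (p : seq T) :
  (forall i, (i < size p)%N -> x i = y i) -> on_path x p = on_path y p.
Proof. by move=> /mkseq_eqP/eqP; rewrite /on_path => ->. Qed.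

Lemma on_path_nth (T : eqType) (x : nat -> T) t0 (p : seq T) i :
  on_path x p -> (i < size p)%N -> nth t0 p i = x i.
Proof. by move=> /eqP px ip; rewrite px nth_mkseq. Qed.

Lemma path_count_le b r (x : nat -> 'I_b) k (W : pred (r.-bseq 'I_b)) :
  (forall p : r.-bseq 'I_b, W p -> on_path x p && (k <= size p < r)%N) ->
  (#|W| <= r - k)%N.
Proof.
move=> h; rewrite -(size_iota k (r - k)) -[leqRHS](size_map (fun i =>
  insub_bseq r (mkseq x i))).
rewrite cardE; apply: (uniq_leq_size (enum_uniq W)) => p;
  rewrite mem_enum => /h/andP[/eqP px /andP[kp pr]].
apply/mapP; exists (size p); first by rewrite mem_iota kp subnKC // ltnW //
  (leq_ltn_trans kp).
by rewrite -px; apply: val_inj; rewrite /insub_bseq insubdK // -topredE /= ltnW.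
Qed.

Lemma path_count_ge b r (x : nat -> 'I_b) k (W : pred (r.-bseq 'I_b)) :
  (forall p : r.-bseq 'I_b, on_path x p -> (k <= size p < r)%N -> W p) ->
  (r - k <= #|W|)%N.
Proof.
move=> h; rewrite -(size_iota k (r - k)) -[leqLHS](size_map (fun i =>
  insub_bseq r (mkseq x i))).
have vE i : (k <= i < r)%N -> insub_bseq r (mkseq x i) = mkseq x i :> seq 'I_b.
  by move=> /andP[_ ir]; rewrite /insub_bseq insubdK // -topredE /= size_mkseq ltnW.
have mi i : i \in iota k (r - k) -> (k <= i < r)%N.
  rewrite mem_iota; case: (leqP k r) => kr; first by rewrite subnKC.
  by rewrite (eqP (ltnW kr : _ - _ == 0)%N) addn0 =>
    /andP[/leq_ltn_trans l /l]; rewrite ltnn.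
rewrite cardE; apply: uniq_leq_size.
  rewrite map_inj_in_uniq ?iota_uniq // => i i' /mi /vE Ei /mi /vE Ei' E.
  by rewrite -(size_mkseq x i) -(size_mkseq x i') -Ei -Ei' E.
move=> p /mapP[i /mi hi ->]; rewrite mem_enum; apply: h.
  by rewrite vE // on_path_mkseq.
by rewrite vE // size_mkseq.
Qed.

Lemma prod_if_const (R : realType) (I : finType) (W : pred I) (c : R) :
  \prod_i (if W i then c else 1) = c ^+ #|W|.
Proof. by rewrite -big_mkcond /= prodr_const. Qed.

Section boxes.
Context {b r : nat} (lo one hi : 'I_b).
Context (lo0 : lo = 0 :> nat) (one1 : one = 1 :> nat) (hib : hi = b.-1 :> nat).
Implicit Types (x y : nat -> 'I_b) (p : r.-bseq 'I_b) (s : {perm 'I_b}).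

(** Once the paths of [x] and [y] have separated, [x] continues with the
    smallest digit and [y] with the largest one: this is necessary for the
    scrambled [x] to lie just above the scrambled [y]. *)
Definition squeeze_set x y p : {set {perm 'I_b}} := [set s : {perm 'I_b} |
  ([&& on_path x p, ~~ on_path y p & (size p < r)%N] ==> (s (x (size p)) == lo)) &&
  ([&& on_path y p, ~~ on_path x p & (size p < r)%N] ==> (s (y (size p)) == hi))]%SET.

(** At the last common prefix, [x] gets digit 1 and [y] digit 0, which is one of
    the ways to put the scrambled [x] in the next larger interval. *)
Definition split_set x y p : {set {perm 'I_b}} := [set s : {perm 'I_b} |
  [&& on_path x p, on_path y p, x (size p) != y (size p) & (size p < r)%N] ==>
    (s (x (size p)) == one) && (s (y (size p)) == lo)]%SET.

Definition adjacent_set x y p := (split_set x y p :&: squeeze_set x y p)%SET.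

(** Each of the two paths contributes at least [r - k] prefixes at which one value
    of the permutation is prescribed. *)
Lemma squeeze_prob (R : realType) x y k :
  (forall i, (k <= i < r)%N -> mkseq x i != mkseq y i) ->
  \prod_p perm_prob R (squeeze_set x y p) <= b%:R ^- (2 * (r - k)).
Proof.
move=> h; have b1 : 1 <= b%:R :> R by rewrite ler1n; apply: leq_ltn_trans (ltn_ord lo).
have bi : 0 <= (b%:R : R)^-1 <= 1 by rewrite invr_ge0 ler0n invf_le1 //
  (lt_le_trans ltr01).
pose Wx := [pred p : r.-bseq 'I_b | [&& on_path x p, ~~ on_path y p & (size p < r)%N]].
pose Wy := [pred p : r.-bseq 'I_b | [&& on_path y p, ~~ on_path x p & (size p < r)%N]].
have hx : (r - k <= #|Wx|)%N.
  apply: (@path_count_ge _ _ x) => p px pr; rewrite /= px;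
    case/andP: (pr) => _ ->; rewrite andbT.
  by apply: contra (h _ pr) => py; rewrite -(eqP px) -(eqP py).
have hy : (r - k <= #|Wy|)%N.
  apply: (@path_count_ge _ _ y) => p py pr; rewrite /= py;
    case/andP: (pr) => _ ->; rewrite andbT.
  by apply: contra (h _ pr) => px; rewrite -(eqP px) -(eqP py).
apply: (@le_trans _ _ (b%:R^-1 ^+ #|Wx| * b%:R^-1 ^+ #|Wy|)).
  rewrite -!prod_if_const -big_split /=; apply: ler_prod => p _.
  rewrite perm_prob_ge0 /=; case: ifP => [/and3P[px py pr]|_].
    rewrite px /= andbF mulr1 -(perm_prob1 R (x (size p)) lo); apply: perm_probS.
    by apply/fintype.subsetP => s; rewrite /adjacent_set /split_set
      /squeeze_set !inE px py pr /= => /andP[->].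
  case: ifP => [/and3P[py px pr]|_].
    rewrite mul1r -(perm_prob1 R (y (size p)) hi); apply: perm_probS.
    by apply/fintype.subsetP => s; rewrite /adjacent_set /split_set
      /squeeze_set !inE px py pr /= => /andP[_ ->].
  by rewrite mul1r -(perm_probT R b); apply: perm_probS; apply: finset.subsetT.
rewrite -exprVn mulSn mul1n exprD.
by apply: ler_pM; rewrite ?exprn_ge0 ?ler_wiXn2l //; case/andP: bi.
Qed.

(** A common prefix at which [x] and [y] separate carries two prescribed values,
    and counts for both paths; the prefixes of length below [k] impose nothing. *)
Lemma adjacent_prob (R : realType) x y k : (forall i, (i < k)%N -> x i = y i) ->
  b%:R ^- (2 * (r - k)) <= \prod_p perm_prob R (adjacent_set x y p).
Proof.
move=> h; have b1 : 1 <= b%:R :> R by rewrite ler1n; apply: leq_ltn_trans (ltn_ord lo).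
have bi : 0 <= (b%:R : R)^-1 <= 1 by rewrite invr_ge0 ler0n invf_le1 //
  (lt_le_trans ltr01).
have [bi0 bi1] := andP bi.
pose Wx := [pred p : r.-bseq 'I_b | on_path x p && (k <= size p < r)%N].
pose Wy := [pred p : r.-bseq 'I_b | on_path y p && (k <= size p < r)%N].
have hx : (#|Wx| <= r - k)%N by apply: (@path_count_le _ _ x).
have hy : (#|Wy| <= r - k)%N by apply: (@path_count_le _ _ y).
apply: (@le_trans _ _ (b%:R^-1 ^+ #|Wx| * b%:R^-1 ^+ #|Wy|)).
  rewrite -exprVn mulSn mul1n exprD.
  by apply: ler_pM; rewrite ?exprn_ge0 ?ler_wiXn2l.
rewrite -!prod_if_const -big_split /=; apply: ler_prod => p _.
have full (S : {set {perm 'I_b}}) : (forall s, s \in S) -> 1 <= perm_prob R S.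
  move=> hS; rewrite -(perm_probT R b); apply: perm_probS.
  by apply/fintype.subsetP => s _.
have le1 c c' : (if c then b%:R^-1 else 1) * (if c' then b%:R^-1 else 1) <= 1 :> R.
  by case: c; case: c'; rewrite ?mulr1 ?mul1r // mulr_ile1.
have ge0 c c' : 0 <= (if c then b%:R^-1 else 1) * (if c' then b%:R^-1 else 1) :> R.
  by case: c; case: c'; rewrite ?mulr1 ?mul1r ?ler01 // mulr_ge0.
rewrite ge0 /=.
have [pr|pr] := ltnP (size p) r; last first.
  apply: le_trans (le1 _ _) (full _ _) => s.
  by rewrite /adjacent_set /split_set /squeeze_set !inE ltnNge pr /= !andbF.
case: (boolP (on_path x p)) => px; case: (boolP (on_path y p)) => py /=.
- have [xy|xy] := eqVneq (x (size p)) (y (size p)).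
    by apply: le_trans (le1 _ _) (full _ _) => s;
      rewrite /adjacent_set /split_set /squeeze_set !inE px py xy eqxx /=.
  have kp : (k <= size p)%N.
    by rewrite leqNgt; apply: contra xy => /h ->.
  rewrite kp /= -invfM -expr2.
  have ol : one != lo by rewrite -val_eqE /= lo0 one1.
  apply: le_trans (perm_prob2 R xy ol) _; apply: perm_probS.
  by apply/fintype.subsetP => s; rewrite /adjacent_set /split_set /squeeze_set
    !inE px py pr xy /= !andbT.
- have kp : (k <= size p)%N.
    rewrite leqNgt; apply: contra py => pk; rewrite -(on_path_eq (x := x)) // => i ip.
    by apply: h; apply: ltn_trans ip pk.
  rewrite kp mulr1 -(perm_prob1 R (x (size p)) lo); apply: perm_probS.
  by apply/fintype.subsetP => s; rewrite /adjacent_set /split_set /squeeze_set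
    !inE px (negbTE py) pr /= andbT.
- have kp : (k <= size p)%N.
    rewrite leqNgt; apply: contra px => pk; rewrite (on_path_eq (y := y)) // => i ip.
    by apply: h; apply: ltn_trans ip pk.
  rewrite kp mul1r -(perm_prob1 R (y (size p)) hi); apply: perm_probS.
  by apply/fintype.subsetP => s; rewrite /adjacent_set /split_set /squeeze_set
    !inE py (negbTE px) pr /=.
- by rewrite mulr1; apply: full => s;
    rewrite /adjacent_set /split_set /squeeze_set !inE (negbTE px) (negbTE py).
Qed.

(** Only prefixes that extend the common cell of [x] and [y] carry a constraint;
    this is the source of the independence between distinct cells. *)
Lemma adjacent_set_supp x y k p : (forall i, (i < k)%N -> x i = y i) ->
  adjacent_set x y p = [set: {perm 'I_b}]%SET \/
  ((k <= size p)%N /\ forall i, (i < k)%N -> nth lo p i = x i).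
Proof.
move=> h; have [kp|kp] := leqP k (size p).
  case: (boolP (on_path x p)) => px.
    by right; split=> // i ik; apply: on_path_nth => //; apply: leq_trans ik kp.
  case: (boolP (on_path y p)) => py.
    by right; split=> // i ik; rewrite h //; apply: on_path_nth => //;
      apply: leq_trans ik kp.
  by left; apply/setP => s; rewrite /adjacent_set /split_set /squeeze_set !inE
    (negbTE px) (negbTE py).
left; apply/setP => s; rewrite /adjacent_set /split_set /squeeze_set !inE
  (@on_path_eq _ x y) => [|i ip]; last first.
  by apply: h; apply: ltn_trans ip kp.
by rewrite h // eqxx /=; case: on_path.
Qed.

Lemma adjacent_set_disjoint x y x' y' k p :
  (forall i, (i < k)%N -> x i = y i) -> (forall i, (i < k)%N -> x' i = y' i) ->
  ~ (forall i, (i < k)%N -> x i = x' i) ->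
  adjacent_set x y p = [set: {perm 'I_b}]%SET \/
  adjacent_set x' y' p = [set: {perm 'I_b}]%SET.
Proof.
move=> h h' ne; have [|[_ E]] := adjacent_set_supp p h; first by left.
have [|[_ E']] := adjacent_set_supp p h'; first by right.
by case: ne => i ik; rewrite -E // E'.
Qed.

Lemma scrambled_perms_of d (f : config b d r) j x i : (i < r)%N ->
  exists2 p : r.-bseq 'I_b, p = mkseq x i :> seq 'I_b &
    scrambled_digits (perms_of f) j x i = f (j, p) (x i).
Proof.
move=> ir; exists (insub_bseq r (mkseq x i)) => //.
by rewrite /insub_bseq insubdK // -topredE /= size_mkseq ltnW.
Qed.

Lemma adjacent_set_le d (f : config b d r) j x y :
  (forall p, f (j, p) \in adjacent_set x y p) ->
  let u := prefix_num (scrambled_digits (perms_of f) j x) r in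
  let v := prefix_num (scrambled_digits (perms_of f) j y) r in
  (u <= v + 1 /\ v <= u + 1)%N.
Proof.
move=> hf u v; have := @common_prefix_eq _ x y r; have := @common_prefix_neq _ x y r.
have := common_prefix_le x y r; move: (common_prefix x y r) => l.
rewrite leq_eqVlt => /orP[/eqP -> _ /(_ _)/= h|lr /(_ lr) nxy h].
  suff -> : u = v by rewrite leq_addr.
  by apply: prefix_num_eq; apply: scrambled_digits_eq; exact: h.
suff -> : u = v.+1 by rewrite addn1; split=> //; lia.
have split_path i : (l < i)%N -> mkseq x i != mkseq y i.
  by move=> li; apply/mkseq_eqP => /(_ l li) E; rewrite E eqxx in nxy.
apply: (prefix_num_fork lr).
- by apply: scrambled_digits_eq; exact: h.
- have [p px ->] := scrambled_perms_of f j x lr.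
  have [q py ->] := scrambled_perms_of f j y lr.
  have pq : p = q.
    by apply/val_inj; rewrite /= px py; apply/eqP/mkseq_eqP; exact: h.
  have := hf p; have sp : size p = l by rewrite px size_mkseq.
  rewrite /adjacent_set /split_set /squeeze_set !inE sp /on_path sp -px {1}pq
    -py !eqxx nxy lr /=.
  by rewrite -pq eqxx /= => /andP[/andP[/eqP -> /eqP ->] _]; rewrite one1 lo0.
- move=> i /andP[li ir].
  have [p px ->] := scrambled_perms_of f j x ir.
  have [q py ->] := scrambled_perms_of f j y ir.
  have sp : size p = i by rewrite px size_mkseq.
  have sq : size q = i by rewrite py size_mkseq.
  have ne := split_path i li.
  have := hf p; rewrite /adjacent_set /split_set /squeeze_set !inE sp /on_path
    sp -px eqxx px (negbTE ne) ir /= andbT.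
  have := hf q; rewrite /adjacent_set /split_set /squeeze_set !inE sq /on_path
    sq -py eqxx py eq_sym (negbTE ne) ir /=.
  by move=> /eqP -> /eqP ->; rewrite lo0 hib.
Qed.

Lemma squeeze_of_gt d (f : config b d r) j x y l :
  let u := scrambled_digits (perms_of f) j x in
  let v := scrambled_digits (perms_of f) j y in
  (l < r)%N -> (forall i, (i < l)%N -> x i = y i) -> (v l < u l)%N ->
  (prefix_num u r <= (prefix_num v r).+1)%N ->
  forall p, f (j, p) \in squeeze_set x y p.
Proof.
move=> u v lr h vu uv p.
have adj := prefix_num_adjacent lr (scrambled_digits_eq _ _ h) vu uv.
have late i (q : r.-bseq 'I_b) z z' : (forall k, (k < l)%N -> z k = z' k) ->
    on_path z q -> ~~ on_path z' q -> size q = i -> (l < i)%N.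
  move=> hz zq z'q <-; rewrite ltnNge; apply: contra z'q => ql.
  by rewrite -(@on_path_eq _ z) // => k kq; apply: hz; apply: leq_trans kq ql.
have at_path z : on_path z p -> (size p < r)%N ->
    scrambled_digits (perms_of f) j z (size p) = f (j, p) (z (size p)).
  move=> /eqP zp pr; have [q qz ->] := scrambled_perms_of f j z pr.
  by congr (f (j, _) _); apply: val_inj; rewrite /= qz -zp.
rewrite /squeeze_set inE; apply/andP; split; apply/implyP => /and3P[hx hy pr].
  have lp : (l < size p < r)%N by rewrite pr andbT; apply: (late _ p x y).
  by rewrite -at_path // -val_eqE /= lo0; have [-> _] := adj _ lp.
have lp : (l < size p < r)%N.
  by rewrite pr andbT; apply: (late _ p y x) => // k kl; rewrite h.
by rewrite -at_path // -val_eqE /= hib; have [_ ->] := adj _ lp.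
Qed.

(** The two cases are the two orders in which scrambling can place [x] and
    [y]. *)
Lemma close_squeeze d (f : config b d r) j x y :
  let u := scrambled_digits (perms_of f) j x in
  let v := scrambled_digits (perms_of f) j y in
  (prefix_num u r <= (prefix_num v r).+1)%N ->
  (prefix_num v r <= (prefix_num u r).+1)%N ->
  (forall p, f (j, p) \in squeeze_set x y p) \/
  (forall p, f (j, p) \in squeeze_set y x p).
Proof.
move=> u v uv vu; have := @common_prefix_eq _ x y r; have := @common_prefix_neq _ x y r.
have := common_prefix_le x y r; move: (common_prefix x y r) => l.
rewrite leq_eqVlt => /orP[/eqP -> _ h|lr /(_ lr) nxy h].
  left=> p; rewrite /squeeze_set inE.
  have [pr|pr] := ltnP (size p) r; last by rewrite !andbF.
  rewrite (@on_path_eq _ x y) => [|i ip]; last by apply: h; apply: ltn_trans ip pr.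
  by rewrite andbA andbN.
have ne : u l != v l.
  rewrite /u /v /scrambled_digits; have /mkseq_eqP/eqP -> := h.
  by rewrite (inj_eq perm_inj).
move: ne; rewrite -val_eqE neq_ltn => /orP[lt|lt]; [right|left].
  by apply: (@squeeze_of_gt _ _ _ _ _ l) => // i il; rewrite h.
exact: (@squeeze_of_gt _ _ _ _ _ l).
Qed.
End boxes.

(** * Close pairs are unlikely *)

Definition same_cell (R : realType) b d N (P : point_set R b d N) (k : 'I_d -> nat)
    (n n' : 'I_N) : bool :=
  [forall j, prefix_num (digits (P n j)) (k j) == prefix_num (digits (P n' j)) (k j)].

Definition cell_of (R : realType) b d N (P : point_set R b d N) (k : 'I_d -> nat)
    (n : 'I_N) : elem_interval b k :=
  [ffun j => Ordinal (prefix_num_lt (digits (P n j)) (k j))].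

Lemma same_cellE (R : realType) b d N (P : point_set R b d N) k n n' :
  same_cell P k n n' = (cell_of P k n == cell_of P k n').
Proof.
apply/forallP/eqP => [h|E j].
  by apply/ffunP => j; rewrite !ffunE; apply: val_inj; apply/eqP/h.
by move/ffunP: E => /(_ j); rewrite !ffunE => -[->].
Qed.

Lemma count_inE (R : realType) b d N (P : point_set R b d N) k a :
  count_in P a = #|[set n | cell_of P k n == a]%SET|.
Proof.
apply: eq_card => n; rewrite [RHS]inE; apply/idP/eqP; rewrite inE; last first.
  by move=> <-; apply/forallP => j; rewrite coord_inE ffunE.
by move=> /forallP h; apply/ffunP => j; rewrite ffunE; apply: val_inj;
  apply/eqP; rewrite /= -coord_inE.
Qed.

Lemma card_distinct_pairs (T : finType) (C : {set T}) :
  #|[set q : T * T | [&& q.1 \in C, q.2 \in C & q.1 != q.2]]%SET| = (#|C| *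
    (#|C| - 1))%N.
Proof.
rewrite -sum1_card (eq_bigl (fun q : T * T => (q.1 \in C) && (q.2 \in C :\ q.1)%SET)).
  rewrite -(pair_big_dep (mem C) (fun n n' => n' \in (C :\ n)%SET) (fun _ _ => 1%N)) /=.
  rewrite -sum_nat_const; apply: eq_bigr => n nC.
  by rewrite sum1_card (cardsD1 n C) nC add1n subn1.
by move=> q; rewrite !inE (eq_sym q.2); case: (q.1 \in C); rewrite //= andbC.
Qed.

Lemma same_cell_pairs (R : realType) b d N (P : point_set R b d N) k :
  (#|[set q : 'I_N * 'I_N | (q.1 != q.2) && same_cell P k q.1 q.2]%SET| <=
   coincidences P k)%N.
Proof.
rewrite -sum1_card (partition_big (fun q => cell_of P k q.1) xpredT) //=.
apply: leq_sum => a _; rewrite count_inE -card_distinct_pairs sum1_card.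
apply: subset_leq_card; apply/fintype.subsetP => q; rewrite !inE unfold_in /= !inE.
move=> /andP[/andP[ne]]; rewrite same_cellE => /eqP <- ->.
by rewrite ne.
Qed.

Lemma same_cell_level (R : realType) b d m t kappa (P : forall m, point_set R b
  d (b ^ m))
    k n n' : prefix_cutoff t kappa P -> (t <= m)%N ->
  n != n' -> same_cell (P m) k n n' -> (\sum_(j < d) k j < m + kappa)%N.
Proof.
move=> cut tm ne; rewrite same_cellE => /eqP E; rewrite ltnNge; apply/negP => big.
have := cut m tm k big (cell_of (P m) k n); rewrite count_inE => /card_le1_eqP h.
by have := h n n'; rewrite !inE E eqxx => /(_ erefl erefl) E'; rewrite E' eqxx in ne.
Qed.

(** A level vector is determined by all its entries but one, of which there are
    at most [L ^ d] choices, together with its sum [s < L]; and the sum of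
    [b ^ s] over [s < L] is at most [b ^ L]. *)
Lemma sum_levels_le b d r L : (1 < b)%N ->
  (\sum_(k : {ffun 'I_d.+1 -> 'I_r.+1} | \sum_j k j < L) b ^ (\sum_j k j) <=
   L ^ d * b ^ L)%N.
Proof.
move=> b1; case: L => [|L]; first by rewrite big1.
pose phi (k : {ffun 'I_d.+1 -> 'I_r.+1}) : {ffun 'I_d -> 'I_L.+1} * 'I_L.+1 :=
  ([ffun j => inord (k (lift ord0 j))], inord (\sum_j k j)%N).
pose D := [set k : {ffun 'I_d.+1 -> 'I_r.+1} | (\sum_j k j < L.+1)%N]%SET.
have small k j : k \in D -> (k j < L.+1)%N.
  by rewrite inE; apply: leq_ltn_trans; rewrite (bigD1 j) //= leq_addr.
have phi_inj : {in D &, injective phi}.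
  move=> k k' kD k'D E.
  have Es : (\sum_j k j = \sum_j k' j)%N.
    have := congr1 (fun q : {ffun 'I_d -> 'I_L.+1} * 'I_L.+1 =>
      nat_of_ord q.2) E; rewrite /phi /= !inordK //.
      by move: k'D; rewrite inE.
    by move: kD; rewrite inE.
  have El (j : 'I_d) : k (lift ord0 j) = k' (lift ord0 j).
    have := congr1 (fun q : {ffun 'I_d -> 'I_L.+1} * 'I_L.+1 => nat_of_ord (q.1 j)) E.
    by rewrite /phi /= !ffunE !inordK ?small // => /val_inj.
  apply/ffunP => j; case: (unliftP ord0 j) => [i ->|->]; first exact: El.
  apply: val_inj; apply/eqP; move: Es;
    rewrite !big_ord_recl (eq_bigr _ (fun i _ => congr1 val (El i))).
  by move/eqP; rewrite eqn_add2r.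
rewrite (eq_bigl (fun k => k \in D)) => [|k]; last by rewrite inE.
rewrite (eq_bigr (fun k => b ^ (phi k).2)%N) => [|k]; last first.
  by move=> kD; rewrite /= inordK //; move: kD; rewrite inE.
rewrite -(big_imset (fun q : {ffun 'I_d -> 'I_L.+1} * 'I_L.+1 => b ^ q.2)%N phi_inj) /=.
apply: leq_trans (_ : \sum_(q : {ffun 'I_d -> 'I_L.+1} * 'I_L.+1) b ^ q.2 <= _)%N.
  by rewrite big_mkcond; apply: leq_sum => q _; case: ifP.
rewrite -(pair_big xpredT xpredT (fun (_ : {ffun 'I_d -> 'I_L.+1}) (s :
  'I_L.+1) => b ^ s)%N) /=.
rewrite sum_nat_const card_ffun !card_ord leq_mul2l; apply/orP; right.
elim: L.+1 => [|n IH]; first by rewrite big_ord0.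
by rewrite big_ord_recr /= expnS; move: IH; set u := \sum_(_ < _) _; nia.
Qed.

Definition close_configs b d r (lo hi : 'I_b) (x y : 'I_d -> nat -> 'I_b) :
  {set config b d r} := [set f : config b d r | [forall j,
    [forall p, f (j, p) \in squeeze_set lo hi (x j) (y j) p] ||
    [forall p, f (j, p) \in squeeze_set lo hi (y j) (x j) p]]]%SET.

(** Union bound over the order of the two points in each of the coordinates,
    followed by [squeeze_prob]. *)
Lemma close_configs_prob (R : realType) b d r (lo hi : 'I_b)
    (x y : 'I_d -> nat -> 'I_b) :
  #|close_configs r lo hi x y|%:R / #|config b d r|%:R <=
  \prod_j (2 * b%:R ^- (2 * (r - (common_prefix (x j) (y j) r).+1))) :> R.
Proof.
pose B (s : {ffun 'I_d -> bool}) j (p : r.-bseq 'I_b) :=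
  if s j then squeeze_set lo hi (x j) (y j) p else squeeze_set lo hi (y j) (x j) p.
have late j i : ((common_prefix (x j) (y j) r).+1 <= i < r)%N ->
    mkseq (x j) i != mkseq (y j) i.
  move=> /andP[li ir]; apply/mkseq_eqP => /(_ _ li) E.
  by have := common_prefix_neq (ltn_trans li ir); rewrite E eqxx.
apply: (@le_trans _ _ (\sum_(s : {ffun 'I_d -> bool}) #|box (B s)|%:R /
  #|config b d r|%:R)).
  rewrite -mulr_suml ler_pM2r; last first.
    by rewrite invr_gt0 ltr0n; apply/card_gt0P; exists [ffun=> 1%g].
  rewrite -natr_sum ler_nat; apply: (union_bound (P := xpredT)) => f.
  rewrite inE => /forallP h.
  exists [ffun j => [forall p, f (j, p) \in squeeze_set lo hi (x j) (y j) p]] => //.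
  rewrite inE; apply/forallP => -[j p] /=; rewrite /B ffunE.
  case: ifP => [/forallP //|hn]; have := h j; rewrite hn /= => /forallP; exact.
apply: (@le_trans _ _ (\sum_(s : {ffun 'I_d -> bool})
    \prod_j b%:R ^- (2 * (r - (common_prefix (x j) (y j) r).+1)))).
  apply: ler_sum => s _; rewrite box_prob; apply: ler_prod => j _.
  rewrite prodr_ge0 /=; last by move=> p _; apply: perm_prob_ge0.
  rewrite /B; case: (s j); apply: squeeze_prob => i; first exact: late.
  by rewrite eq_sym; exact: late.
by rewrite sumr_const big_split /= prodr_const card_ffun card_bool card_ord
  -natrX mulr_natl.
Qed.

Lemma scramble_close (R : realType) b d r N (lo hi : 'I_b) (P : point_set R b d N)
    (pi : 'I_d * seq 'I_b -> {perm 'I_b}) n n' :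
  lo = 0%N :> nat -> hi = b.-1 :> nat ->
  `|scramble pi P n - scramble pi P n'| < b%:R ^- r ->
  config_of r pi \in
    close_configs r lo hi (fun j => digits (P n j)) (fun j => digits (P n' j)).
Proof.
move=> lo0 hib close; rewrite inE; apply/forallP => j.
have := le_lt_trans (rV_coord_le _ j) close; rewrite !mxE => cj.
set f := config_of r pi.
have E z : prefix_num (scrambled_digits (perms_of f) j z) r =
           prefix_num (scrambled_digits pi j z) r.
  by apply: prefix_num_eq => i ir; rewrite scrambled_digits_config.
have [||h|h] := @close_squeeze _ r lo hi lo0 hib d f j (digits (P n j)) (digits
  (P n' j)).
- by rewrite !E; apply: (@digit_value_close R); apply: le_lt_trans (ler_norm _) cj.
- rewrite !E; apply: (@digit_value_close R); apply: le_lt_trans (ler_norm _) _.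
  by rewrite distrC.
- by apply/orP; left; apply/forallP.
- by apply/orP; right; apply/forallP.
Qed.

Section small_distance.
Context (R : realType) (b d t kappa m : nat) (A : R)
  (P : forall m : nat, point_set R b d.+1 (b ^ m)).
Context (b1 : (1 < b)%N) (A0 : 0 <= A) (tm : (t <= m)%N)
  (coin : coincidence_bound t A P) (cut : prefix_cutoff t kappa P).
Arguments P : clear implicits.

Let prefix_level r (q : 'I_(b ^ m) * 'I_(b ^ m)) (j : 'I_d.+1) : nat :=
  common_prefix (digits (P m q.1 j)) (digits (P m q.2 j)) r.

(** Each pair is counted at the vector of its common prefix lengths, among all
    the pairs sharing that vector, whose number is controlled by the coincidence
    bound. *)
Lemma sum_prefix_levels r :
  \sum_(q : 'I_(b ^ m) * 'I_(b ^ m) | (q.1 < q.2)%N)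
     b%:R ^+ (2 * \sum_j prefix_level r q j) <=
  A * (b ^ m)%:R ^+ 2 * ((m + kappa) ^ d * b ^ (m + kappa))%:R.
Proof.
have bR : 0 < b%:R :> R by rewrite ltr0n ltnW.
pose L := (m + kappa)%N.
pose sh (k : {ffun 'I_d.+1 -> 'I_r.+1}) (q : 'I_(b ^ m) * 'I_(b ^ m)) :=
  (q.1 != q.2) && same_cell (P m) (fun j => k j : nat) q.1 q.2.
apply: (@le_trans _ _ (\sum_(q : 'I_(b ^ m) * 'I_(b ^ m))
  \sum_(k : {ffun 'I_d.+1 -> 'I_r.+1} | (\sum_j k j < L)%N && sh k q)
    b%:R ^+ (2 * \sum_j k j))).
  rewrite big_mkcond; apply: ler_sum => q _.
  have pos : 0 <= \sum_(k : {ffun 'I_d.+1 -> 'I_r.+1} | (\sum_j k j < L)%N && sh k q)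
    b%:R ^+ (2 * \sum_j k j) :> R by apply: sumr_ge0 => k _; rewrite exprn_ge0 // ltW.
  case: ifP => // lt.
  pose k : {ffun 'I_d.+1 -> 'I_r.+1} := [ffun j => inord (prefix_level r q j)].
  have kE j : k j = prefix_level r q j :> nat.
    by rewrite ffunE inordK // ltnS common_prefix_le.
  have shk : sh k q.
    rewrite /sh -val_eqE neq_ltn lt /=; apply/forallP => j; apply/eqP.
    by apply: prefix_num_eq => i; rewrite kE; apply: common_prefix_eq.
  rewrite (bigD1 k) /=; last first.
    by rewrite shk andbT; case/andP: shk => ne; exact: same_cell_level cut tm ne.
  rewrite (eq_bigr _ (fun j _ => kE j)) lerDl.
  by apply: sumr_ge0 => k' _; rewrite exprn_ge0 // ltW.
rewrite (exchange_big_dep (fun k : {ffun 'I_d.+1 -> 'I_r.+1} =>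
  (\sum_j k j < L)%N)) /=; last first.
  by move=> q k _ /andP[].
apply: (@le_trans _ _ (\sum_(k : {ffun 'I_d.+1 -> 'I_r.+1} | (\sum_j k j < L)%N)
   A * (b ^ m)%:R ^+ 2 * b%:R ^+ (\sum_j k j))).
  apply: ler_sum => k kL; rewrite kL /= sumr_const.
  have h : #|sh k|%:R <= A * (b ^ m)%:R ^+ 2 / b%:R ^+ (\sum_(j < d.+1) k j)%N.
    apply: (@le_trans _ _ ((coincidences (P m) (fun j => k j : nat))%:R : R)).
      rewrite ler_nat; apply: leq_trans (same_cell_pairs _ _).
      by apply: subset_leq_card; apply/fintype.subsetP => q; rewrite inE.
    have hc := coin tm (fun j => k j : nat); apply: (le_trans hc);
      rewrite ler_pM2r ?invr_gt0 ?exprn_gt0 //.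
    by rewrite expr2 mulrA ler_wpM2l ?mulr_ge0 // lerBlDr lerDl.
  rewrite -[leLHS]mulr_natl mul2n -addnn exprD [leLHS]mulrA.
  by rewrite ler_pM2r ?exprn_gt0 // -ler_pdivlMr ?exprn_gt0.
rewrite -mulr_sumr ler_wpM2l ?mulr_ge0 ?sqr_ge0 //.
under eq_bigr do rewrite -natrX.
by rewrite -natr_sum ler_nat; apply: sum_levels_le.
Qed.

Context (disp : measure_display) (T : measurableType disp) (Pr : probability T R)
  (pi : T -> 'I_d.+1 * seq 'I_b -> {perm 'I_b}) (owen : owen_permutations Pr pi).

(** Expected number of pairs compatible with a distance below [b^-r]. *)
Lemma R_infty_small_prob r : (0 < m)%N ->
  (Pr [set w | (fine (R_infty (scramble (pi w) (P m))) < b%:R ^- r)%R] <=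
   (A * (2 * b%:R ^+ 2) ^+ d.+1 * b%:R ^+ kappa * (b ^ m)%:R ^+ 3 *
    (m + kappa)%:R ^+ d / b%:R ^+ (2 * r * d.+1))%:E)%E.
Proof.
move=> m0; have bR : 0 < b%:R :> R by rewrite ltr0n ltnW.
have N1 : (1 < b ^ m)%N by rewrite -(exp1n m) ltn_exp2r.
pose lo : 'I_b := Ordinal (ltnW b1).
have hiP : (b.-1 < b)%N by rewrite prednK // ltnW.
pose hi : 'I_b := Ordinal hiP.
pose C (q : 'I_(b ^ m) * 'I_(b ^ m)) : {set config b d.+1 r} :=
  close_configs r lo hi (fun j => digits (P m q.1 j)) (fun j => digits (P m q.2 j)).
pose Q : {set config b d.+1 r} := 
  [set f | [exists q : 'I_(b ^ m) * 'I_(b ^ m), (q.1 < q.2)%N && (f \in C q)]]%SET.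
apply: (@le_trans _ _ (Pr [set w | config_of r (pi w) \in Q])).
  apply: le_measure; rewrite ?inE.
  - by apply: measurable_lt_set; [exact: measurable_R_infty owen b1 N1|exact:
      measurable_cst].
  - exact: (measurable_config owen Q).
  - move=> w /= small; rewrite inE; apply/existsP.
    have : (R_infty (scramble (pi w) (P m)) < (b%:R ^- r)%:E)%E.
      by rewrite -lte_fin fineK ?R_infty_fin_num // in small.
    move=> /bigmin_ltP[//|[q lt]]; rewrite lte_fin => close; exists q.
    by rewrite lt /=; apply: scramble_close close.
rewrite (prob_config owen) lee_fin.
apply: (@le_trans _ _ (\sum_(q : 'I_(b ^ m) * 'I_(b ^ m) | (q.1 < q.2)%N)
   #|C q|%:R / #|config b d.+1 r|%:R)).
  rewrite -mulr_suml ler_pM2r; last first.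
    by rewrite invr_gt0 ltr0n; apply/card_gt0P; exists [ffun=> 1%g].
  rewrite -natr_sum ler_nat; apply: union_bound => f;
    rewrite inE => /existsP[q /andP[lt fq]].
  by exists q.
apply: (@le_trans _ _ (\sum_(q : 'I_(b ^ m) * 'I_(b ^ m) | (q.1 < q.2)%N)
   (2 * b%:R ^+ 2) ^+ d.+1 / b%:R ^+ (2 * r * d.+1) *
     b%:R ^+ (2 * \sum_j prefix_level r q j))).
  apply: ler_sum => q _; apply: le_trans (close_configs_prob _ _ _ _ _ _) _.
  have -> : (2 * b%:R ^+ 2) ^+ d.+1 / b%:R ^+ (2 * r * d.+1) *
     b%:R ^+ (2 * \sum_j prefix_level r q j) =
     \prod_j (2 * b%:R ^+ 2 / b%:R ^+ (2 * r) * b%:R ^+ (2 * prefix_level r q j)) :> R.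
    rewrite big_split /= prodr_const card_ord expr_div_n -exprM; congr (_ * _).
    by rewrite big_distrr /= expr_sum.
  apply: ler_prod => j _; apply/andP; split.
    by rewrite mulr_ge0 // invr_ge0 exprn_ge0 // ltW.
  have -> : 2 * b%:R ^+ 2 / b%:R ^+ (2 * r) * b%:R ^+ (2 * prefix_level r q j) =
      2 * (b%:R ^+ (2 + 2 * prefix_level r q j) / b%:R ^+ (2 * r)) :> R.
    by rewrite exprD; ring.
  rewrite ler_pM2l ?ltr0n // ler_pdivlMr ?exprn_gt0 // mulrC.
  rewrite ler_pdivrMr ?exprn_gt0 // -exprD ler_eXn2l ?ltr1n //.
  by have := common_prefix_le (digits (P m q.1 j)) (digits (P m q.2 j)) r;
    rewrite /prefix_level; lia.
rewrite -mulr_sumr.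
apply: le_trans (ler_wpM2l _ (sum_prefix_levels r)) _.
  by rewrite mulr_ge0 ?invr_ge0 ?exprn_ge0 ?mulr_ge0 ?exprn_ge0 // ltW.
rewrite le_eqVlt; apply/orP; left; apply/eqP.
by rewrite expnD !natrM !natrX; ring.
Qed.
End small_distance.

(** * A close pair is likely *)

(** The two points are taken in two of the [b] intervals that split the cube
    along its first coordinate.  Their volume [b^-(k * (d+1) + 1)] is at least
    [b^(t-m)], so each of them contains a point. *)
Lemma net_pair (R : realType) b d t m k (P : point_set R b d.+1 (b ^ m)) : (1 < b)%N ->
  is_net t P -> (d.+1 * k + 1 + t <= m)%N ->
  forall e : {ffun 'I_d.+1 -> 'I_(b ^ k)}, exists q : 'I_(b ^ m) * 'I_(b ^ m),
    q.1 != q.2 /\ forall j, prefix_num (digits (P q.1 j)) k = e j /\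
                            prefix_num (digits (P q.2 j)) k = e j.
Proof.
move=> b1 net km e; have b0 := ltnW b1.
have /choice[v ve] j := prefix_num_surj b0 (ltn_ord (e j)).
(* One more digit in the first coordinate tells the two points apart. *)
pose kk (j : 'I_d.+1) := (k + (j == ord0))%N.
have kkm : (\sum_j kk j + t <= m)%N.
  by rewrite big_split /= sum_nat_const card_ord big_ord_recl big1 ?addn0.
pose u (c : 'I_b) j i := if i == k then c else v j i.
have hit c : exists n, digits (P n ord0) k = c /\
    forall j, prefix_num (digits (P n j)) k = e j.
  have [n hn] := net_hit (u c) b0 (ltn0Sn d) net kkm.
  exists n; split; first by rewrite hn /u ?eqxx // /kk addn1.
  move=> j; rewrite -ve; apply: prefix_num_eq => i ik.
  by rewrite hn /u ?ltn_eqF // (leq_trans ik) // leq_addr.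
have [n [n0 ne]] := hit (Ordinal b0); have [n' [n'1 n'e]] := hit (Ordinal b1).
exists (n, n'); split=> [|j] //=; apply/eqP => nn.
by move: n0; rewrite nn n'1.
Qed.

Section large_distance.
Context (R : realType) (b d t m k : nat) (P : point_set R b d.+1 (b ^ m)).
Context (b1 : (1 < b)%N) (net : is_net t P) (km : (d.+1 * k + 1 + t <= m)%N).
Context (disp : measure_display) (T : measurableType disp) (Pr : probability T R)
  (pi : T -> 'I_d.+1 * seq 'I_b -> {perm 'I_b}) (owen : owen_permutations Pr pi).

(** The sum over pairs of cubes of a product over coordinates is the power of
    a one-dimensional sum, in which the [b ^ k] diagonal terms equal [c]. *)
Lemma sum_collisions (c : R) :
  \sum_(e : {ffun 'I_d.+1 -> 'I_(b ^ k)}) \sum_(e' : {ffun 'I_d.+1 -> 'I_(b ^ k)})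
     \prod_j (if e j == e' j then c else 1) =
  ((b ^ k)%:R * ((b ^ k)%:R - 1 + c)) ^+ d.+1.
Proof.
under eq_bigr => e _ do
  rewrite -(bigA_distr_bigA (fun j (a : 'I_(b ^ k)) => if e j == a then c else 1)).
rewrite -(bigA_distr_bigA (fun (j : 'I_d.+1) (a : 'I_(b ^ k)) =>
  \sum_a' if a == a' then c else 1)).
rewrite prodr_const card_ord; congr (_ ^+ _).
rewrite (eq_bigr (fun=> (b ^ k)%:R - 1 + c)) ?sumr_const ?card_ord ?mulr_natl // => a _.
rewrite (bigD1 a) //= eqxx addrC; congr (_ + _).
rewrite (eq_bigr (fun=> 1)) => [|a' ne]; last by rewrite eq_sym (negbTE ne).
have -> : (b ^ k)%:R - 1 = ((b ^ k).-1)%:R :> R.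
  by rewrite -subn1 natrB // expn_gt0 ltnW.
rewrite sumr_const; congr (_ *+ _).
by rewrite -[in RHS](card_ord (b ^ k)) -(cardC1 a).
Qed.

Lemma R_infty_large_prob r : (0 < m)%N ->
  (Pr [set w | (2 * b%:R ^- r < fine (R_infty (scramble (pi w) P)))%R] <=
   ((1 + (b%:R ^+ (2 * (r - k)) - 1) / b%:R ^+ k) ^+ d.+1 - 1)%:E)%E.
Proof.
move=> m0; have b0 := ltnW b1; have bR : 0 < b%:R :> R by rewrite ltr0n.
have N1 : (1 < b ^ m)%N by rewrite -(exp1n m) ltn_exp2r.
pose lo : 'I_b := Ordinal b0; pose one : 'I_b := Ordinal b1.
have hiP : (b.-1 < b)%N by rewrite prednK.
pose hi : 'I_b := Ordinal hiP.
have /choice[q hq] := net_pair b1 net km.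
pose x e j := digits (P (q e).1 j); pose y e j := digits (P (q e).2 j).
pose B e j (p : r.-bseq 'I_b) := adjacent_set lo one hi (x e j) (y e j) p.
pose Y e : {set config b d.+1 r} := box (B e).
pose Q : {set config b d.+1 r} := [set f | [forall e, f \notin Y e]]%SET.
have xy e j i : (i < k)%N -> x e j i = y e j i.
  by apply: prefix_num_inj; have [_ /(_ j)[-> ->]] := hq e.
pose g e j : R := \prod_p perm_prob R (B e j p).
have g_ge e j : b%:R ^- (2 * (r - k)) <= g e j by apply: adjacent_prob => //; apply: xy.
have g_gt0 e j : 0 < g e j.
  by apply: lt_le_trans (g_ge e j); rewrite invr_gt0 exprn_gt0.
pose c : R := b%:R ^+ (2 * (r - k)).
have T0 : (0 < #|config b d.+1 r|)%N by apply/card_gt0P; exists [ffun=> 1%g].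
apply: (@le_trans _ _ (Pr [set w | config_of r (pi w) \in Q])).
  apply: le_measure; rewrite ?inE.
  - by apply: measurable_lt_set; [exact: measurable_cst|exact:
      measurable_R_infty owen b1 N1].
  - exact: (measurable_config owen Q).
  - move=> w /= large; rewrite inE; apply/forallP => e; apply/negP.
    rewrite inE => /forallP hf; move: large; rewrite ltNge => /negP; apply.
    rewrite -lee_fin fineK ?R_infty_fin_num //.
    have near : `|scramble (pi w) P (q e).1 - scramble (pi w) P (q e).2| <= 2 *
      b%:R ^- r.
      apply/rV_norm_leP => [|j]; first by rewrite mulr_ge0 // invr_ge0 exprn_ge0.
      rewrite !mxE.
      have [] := @adjacent_set_le _ r lo one hi erefl erefl erefl _ (config_of
        r (pi w)) j
        (x e j) (y e j) (fun p => hf (j, p)).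
      have E z : prefix_num (scrambled_digits (perms_of (config_of r (pi w))) j z) r =
           prefix_num (scrambled_digits (pi w) j z) r.
        by apply: prefix_num_eq => i ir; rewrite scrambled_digits_config.
      by rewrite !E => h1 h2; apply: (@digit_value_dist R _ _ _ r 1).
    have [ne _] := hq e; move: ne; rewrite -val_eqE neq_ltn => /orP[lt|lt].
      by apply: (bigmin_inf (q e)) => //; rewrite lee_fin.
    by apply: (bigmin_inf ((q e).2, (q e).1)) => //; rewrite lee_fin distrC.
rewrite (prob_config owen) lee_fin.
have I0 : (0 < #|{: {ffun 'I_d.+1 -> 'I_(b ^ k)}}|)%N.
  by rewrite card_ffun !card_ord expn_gt0 expn_gt0 b0.
apply: le_trans (@second_moment R _ _ Y Q
  (fun e e' => \prod_j (if e j == e' j then c else 1)) T0 I0 _ _ _) _.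
- by move=> e; rewrite box_prob; apply: prodr_gt0 => j _; apply: g_gt0.
- move=> e e'; rewrite boxI !box_prob -!big_split /=; apply: ler_prod => j _.
  rewrite prodr_ge0 => [|p _]; last exact: perm_prob_ge0.
  have [E|E] := eqVneq (e j) (e' j).
    apply: (@le_trans _ _ (g e j)).
      apply: ler_prod => p _; rewrite perm_prob_ge0 /=; apply: perm_probS.
      exact: finset.subsetIl.
    rewrite -mulrA ler_peMr ?(ltW (g_gt0 _ _)) //.
    by rewrite -ler_pdivrMr ?exprn_gt0 // mul1r; apply: g_ge.
  rewrite mulr1 -big_split /= le_eqVlt; apply/orP; left; apply/eqP.
  apply: eq_bigr => p _.
  have [->|->] : B e j p = [set: {perm 'I_b}]%SET \/ B e' j p = [set: {perm 'I_b}]%SET.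
    apply: (@adjacent_set_disjoint _ r lo one hi _ _ _ _ k); [exact: xy|exact: xy|].
    move=> /prefix_num_eq; have [_ /(_ j)[-> _]] := hq e;
      have [_ /(_ j)[-> _]] := hq e'.
    by move=> /val_inj Ee; rewrite Ee eqxx in E.
  + by rewrite finset.setTI perm_probT mul1r.
  + by rewrite finset.setIT perm_probT mulr1.
- by move=> f e; rewrite inE => /forallP.
rewrite lerD2r sum_collisions card_ffun !card_ord le_eqVlt; apply/orP; left; apply/eqP.
have -> : ((b ^ k) ^ d.+1)%:R ^+ 2 = ((b ^ k)%:R ^+ 2) ^+ d.+1 :> R.
  by rewrite natrX -!exprM mulnC.
rewrite -expr_div_n; congr (_ ^+ _).
have kR : b%:R ^+ k != 0 :> R by rewrite gt_eqF ?exprn_gt0.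
by rewrite !natrX /c; field.
Qed.
End large_distance.

(** * Tail bounds at real thresholds *)

(** For the least exponent with [b^-r <= y], the power is within a factor [b] of
    [y], unless that exponent is 0. *)
Lemma exists_scale (R : realType) b (y : R) : (1 < b)%N -> 0 < y ->
  exists r, b%:R ^- r <= y /\ (r = 0%N \/ y < b%:R * b%:R ^- r).
Proof.
move=> b1 y0; have bR : 0 < b%:R :> R by rewrite ltr0n ltnW.
have ex : exists r, (b%:R ^- r <= y).
  exists (Num.bound y^-1); rewrite -[leRHS]invrK lef_pV2 ?posrE ?exprn_gt0 ?invr_gt0 //.
  have yi : 0 < y^-1 by rewrite invr_gt0.
  apply: le_trans (ltW (archi_boundP (ltW yi))) _.
  by rewrite -natrX ler_nat ltnW // ltn_expl.
case: (ex_minnP ex) => r hr minr; exists r; split=> //.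
case: r hr minr => [|r] hr minr; [by left|right].
rewrite exprS invfM mulrA divff ?gt_eqF // mul1r ltNge; apply/negP => /minr.
by rewrite ltnn.
Qed.

Lemma expr_1D_le (R : realType) (u : R) n : 0 <= u <= 1 ->
  (1 + u) ^+ n - 1 <= (2 ^+ n - 1) * u.
Proof.
move=> /andP[u0 u1]; elim: n => [|n IH]; first by rewrite !expr0 subrr mul0r.
have : 1 <= 2 ^+ n :> R by rewrite -natrX ler1n expn_gt0.
rewrite !exprS; move: IH; set p := (1 + u) ^+ n; set q := 2 ^+ n => IH q1.
have h1 : (1 + u) * p <= (1 + u) * (1 + (q - 1) * u).
  by rewrite ler_wpM2l ?addr_ge0 //; lra.
have h2 : (q - 1) * u * u <= (q - 1) * u.
  by rewrite ler_piMr // mulr_ge0 // subr_ge0.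
apply: (@le_trans _ _ ((1 + u) * (1 + (q - 1) * u) - 1)); first by rewrite lerD2r.
rewrite -subr_ge0 (_ : _ - _ = (q - 1) * u - (q - 1) * u * u) ?subr_ge0 //; ring.
Qed.

Section scale.
Context (R : realType) (b d : nat).

(** For dimension [d.+1], the square is the inverse of the order of [h], and the
    cube is, up to logarithms, the inverse of that of [R]; in terms of it all
    powers of [N] in the statement have integer exponents. *)
Definition net_scale m : R := (b ^ m)%:R `^ (1 / (2 * d.+1%:R)).

Definition log_scale m : R := ln ((b ^ m)%:R : R) `^ (d%:R / (2 * d.+1%:R)).

Context (b1 : (1 < b)%N).

Lemma net_scale_gt0 m : 0 < net_scale m.
Proof. by rewrite powR_gt0 // ltr0n expn_gt0 ltnW. Qed.

Lemma log_scale_gt0 m : (0 < m)%N -> 0 < log_scale m.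
Proof. by move=> m0; rewrite powR_gt0 // ln_gt0 // ltr1n -(exp1n m) ltn_exp2r. Qed.

Lemma powR_net_scale m n : (b ^ m)%:R `^ (n%:R / (2 * d.+1%:R)) = net_scale m ^+ n.
Proof. by rewrite -powR_mulrn ?powR_ge0 // -powRrM div1r mulrC. Qed.

Lemma powR_net_scaleN m n :
  (b ^ m)%:R `^ (- (n%:R / (2 * d.+1%:R))) = (net_scale m ^+ n)^-1.
Proof. by rewrite powRN powR_net_scale. Qed.

Lemma net_scaleX m : net_scale m ^+ (2 * d.+1) = (b ^ m)%:R.
Proof.
rewrite -powR_mulrn ?powR_ge0 // /net_scale -powRrM natrM div1r mulVf ?powRr1 ?ler0n //.
Qed.

Lemma net_scale2_le m e : (m <= d.+1 * e)%N -> net_scale m ^+ 2 <= b%:R ^+ e.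
Proof.
move=> me; have g0 := ltW (net_scale_gt0 m).
rewrite -(@ler_pXn2r _ d.+1) ?nnegrE ?exprn_ge0 ?ler0n //.
by rewrite -!exprM net_scaleX natrX ler_eXn2l ?ltr1n // mulnC.
Qed.

Lemma net_scale2_ge m e : (d.+1 * e <= m)%N -> b%:R ^+ e <= net_scale m ^+ 2.
Proof.
move=> me; have g0 := ltW (net_scale_gt0 m).
rewrite -(@ler_pXn2r _ d.+1) ?nnegrE ?exprn_ge0 ?ler0n //.
by rewrite -!exprM net_scaleX natrX ler_eXn2l ?ltr1n // mulnC.
Qed.

End scale.

Section tails.
Context (R : realType) (b d t m : nat) (b1 : (1 < b)%N).
Local Notation gamma := (net_scale R b d m).
Context (disp : measure_display) (T : measurableType disp) (Pr : probability T R)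
  (pi : T -> 'I_d.+1 * seq 'I_b -> {perm 'I_b}) (owen : owen_permutations Pr pi).

(** At [r <= k] the bound of [R_infty_large_prob] is zero, which also covers the
    thresholds [y] of order one. *)
Lemma R_infty_large_tail (P : point_set R b d.+1 (b ^ m)) y :
  is_net t P -> (t < m)%N -> 0 < y ->
  (Pr [set w | (y < fine (R_infty (scramble (pi w) P)))%R] <=
   ((1 + 4 * b%:R ^+ 2 * b%:R ^+ (t + 2) ^+ 3 / (y * gamma ^+ 3) ^+ 2) ^+ d.+1
     - 1)%:E)%E.
Proof.
move=> net tm y0; have m0 : (0 < m)%N by apply: leq_ltn_trans tm.
have bR : 0 < b%:R :> R by rewrite ltr0n ltnW.
have N1 : (1 < b ^ m)%N by rewrite -(exp1n m) ltn_exp2r.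
have g0 : 0 < gamma by apply: net_scale_gt0.
pose k := ((m - t.+1) %/ d.+1)%N.
have km : (d.+1 * k + 1 + t <= m)%N.
  by rewrite -addnA add1n -[leqRHS](subnK tm) leq_add2r mulnC leq_trunc_div.
have mk : (m <= d.+1 * (k + (t + 2)))%N.
  have := ltn_ceil (m - t.+1) (ltn0Sn d); rewrite -/k; nia.
have [r [hr r0]] := exists_scale b1 (divr_gt0 y0 (ltr0n R 2)).
apply: (@le_trans _ _ (Pr [set w | (2 * b%:R ^- r < fine (R_infty (scramble (pi
  w) P)))%R])).
  apply: le_measure; rewrite ?inE.
  - by apply: measurable_lt_set; [exact: measurable_cst|exact:
      measurable_R_infty owen b1 N1].
  - by apply: measurable_lt_set; [exact: measurable_cst|exact:
      measurable_R_infty owen b1 N1].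
  - by move=> w /=; apply: le_lt_trans; rewrite mulrC -ler_pdivlMr.
apply: le_trans (R_infty_large_prob b1 net km owen r m0) _.
have ek n : 0 < b%:R ^+ n :> R by rewrite exprn_gt0.
have one_le n : 1 <= b%:R ^+ n :> R by rewrite exprn_ege1 // ler1n ltnW.
have q0 : 0 <= 4 * b%:R ^+ 2 * b%:R ^+ (t + 2) ^+ 3 / (y * gamma ^+ 3) ^+ 2.
  by rewrite divr_ge0 ?sqr_ge0 // !mulr_ge0 // ?exprn_ge0 // ltW.
rewrite lee_fin lerD2r lerXn2r ?nnegrE ?addr_ge0 //.
  by rewrite divr_ge0 ?(ltW (ek _)) // subr_ge0.
rewrite lerD2l.
have [rk|kr] := leqP r k.
  by rewrite (eqP (rk : r - k == 0)%N) muln0 expr0 subrr mul0r.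
have {r0} ry : y / 2 < b%:R * b%:R ^- r by case: r0 => // r0; rewrite r0 in kr.
have E2 : b%:R ^+ (2 * (r - k)) = b%:R ^+ r ^+ 2 / b%:R ^+ k ^+ 2 :> R.
  have -> : b%:R ^+ r = b%:R ^+ k * b%:R ^+ (r - k) :> R by rewrite -exprD
    subnKC // ltnW.
  by rewrite exprMn mulrAC divff ?gt_eqF ?exprn_gt0 // mul1r -exprM mulnC.
have h1 : b%:R ^+ r < 2 * b%:R / y.
  rewrite ltr_pdivlMr // mulrC; move: ry.
  by rewrite ltr_pdivrMr // mulrAC ltr_pdivlMr // [b%:R * 2]mulrC.
have h2 : gamma ^+ 2 <= b%:R ^+ k * b%:R ^+ (t + 2) by rewrite -exprD net_scale2_le.
apply: (@le_trans _ _ ((2 * b%:R / y) ^+ 2 / b%:R ^+ k ^+ 3)).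
  have -> : (2 * b%:R / y) ^+ 2 / b%:R ^+ k ^+ 3 =
      (2 * b%:R / y) ^+ 2 / b%:R ^+ k ^+ 2 / b%:R ^+ k.
    by rewrite [b%:R ^+ k ^+ 3]exprS invfM mulrCA mulrC.
  rewrite E2 ler_pM2r ?invr_gt0 //.
  rewrite lerBlDr; apply: ler_wpDr; first exact: ler01.
  rewrite ler_pM2r ?invr_gt0 ?exprn_gt0 // lerXn2r ?nnegrE ?(ltW (ek _)) //;
    last exact: ltW.
  by rewrite divr_ge0 ?mulr_ge0 // ltW.
have h3 : b%:R ^+ k ^- 3 <= (b%:R ^+ (t + 2) / gamma ^+ 2) ^+ 3.
  rewrite -exprVn lerXn2r ?nnegrE ?invr_ge0 ?divr_ge0 ?(ltW (ek _)) ?sqr_ge0 //.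
  by rewrite ler_pdivlMr ?exprn_gt0 // mulrC ler_pdivrMr // mulrC.
apply: le_trans (ler_wpM2l _ h3) _; first exact: sqr_ge0.
rewrite le_eqVlt; apply/orP; left; apply/eqP; field.
by rewrite !gt_eqF.
Qed.

(** For [b * y >= 1] the right-hand side is at least 1; otherwise [r] is chosen
    with [b^-r] between [y] and [b * y]. *)
Lemma R_infty_small_tail (P : forall m : nat, point_set R b d.+1 (b ^ m)) A kappa y :
  1 <= A -> (t <= m)%N -> (0 < m)%N -> coincidence_bound t A P -> prefix_cutoff
    t kappa P ->
  0 < y ->
  (Pr [set w | (fine (R_infty (scramble (pi w) (P m))) < y)%R] <=
   (A * (2 * b%:R ^+ 2) ^+ d.+1 * b%:R ^+ kappa * b%:R ^+ (2 * d.+1) *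
    (y * gamma ^+ 3) ^+ (2 * d.+1) * (m + kappa)%:R ^+ d)%:E)%E.
Proof.
move=> A1 tm m0 coin cut y0; have bR : 0 < b%:R :> R by rewrite ltr0n ltnW.
have N1 : (1 < b ^ m)%N by rewrite -(exp1n m) ltn_exp2r.
have N1R : 1 <= (b ^ m)%:R :> R by rewrite ler1n ltnW.
have b1R n : 1 <= b%:R ^+ n :> R by rewrite exprn_ege1 // ler1n ltnW.
have two_b : 1 <= 2 * b%:R ^+ 2 :> R by have := b1R 2%N; lra.
have A0 : 0 <= A by apply: le_trans A1.
have [r [hr r0]] := exists_scale b1 (mulr_gt0 bR y0).
have meas z : measurable [set w | (fine (R_infty (scramble (pi w) (P m))) < z)%R].
  by apply: measurable_lt_set; [exact: measurable_R_infty owen b1 N1|exact: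
    measurable_cst].
have E : (y * gamma ^+ 3) ^+ (2 * d.+1) = y ^+ (2 * d.+1) * (b ^ m)%:R ^+ 3.
  by rewrite exprMn -exprM (mulnC 3) [gamma ^+ (_ * 3)]exprM net_scaleX.
have mk : 1 <= (m + kappa)%:R ^+ d :> R by rewrite exprn_ege1 // ler1n addn_gt0 m0.
rewrite E.
have E' : A * (2 * b%:R ^+ 2) ^+ d.+1 * b%:R ^+ kappa * b%:R ^+ (2 * d.+1) *
    (y ^+ (2 * d.+1) * (b ^ m)%:R ^+ 3) * (m + kappa)%:R ^+ d =
    A * (2 * b%:R ^+ 2) ^+ d.+1 * b%:R ^+ kappa * (b ^ m)%:R ^+ 3 * (m +
      kappa)%:R ^+ d *
    (b%:R * y) ^+ (2 * d.+1) by rewrite [(b%:R * y) ^+ _]exprMn; ring.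
rewrite E'; case: r0 => [r0|r0].
  rewrite r0 expr0 invr1 in hr.
  apply: le_trans (probability_le1 _ (meas y)) _.
  rewrite lee_fin; apply: (mulr_ege1 _ (exprn_ege1 _ hr)).
  apply: (mulr_ege1 _ mk); apply: (mulr_ege1 _ (exprn_ege1 3 N1R)).
  exact: (mulr_ege1 (mulr_ege1 A1 (exprn_ege1 _ two_b)) (b1R _)).
apply: (@le_trans _ _ (Pr [set w | (fine (R_infty (scramble (pi w) (P m))) <
  b%:R ^- r)%R])).
  apply: le_measure; rewrite ?inE //.
  by move=> w /= /lt_trans; apply; rewrite -(ltr_pM2l bR).
apply: le_trans (R_infty_small_prob b1 A0 tm coin cut owen r m0) _.
rewrite lee_fin ler_wpM2l // ?mulr_ge0 // ?exprn_ge0 ?(ltW bR) // ?(le_trans ler01) //.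
have -> : (b%:R ^+ (2 * r * d.+1))^-1 = (b%:R ^- r) ^+ (2 * d.+1) :> R.
  by rewrite exprVn -exprM mulnCA mulnA.
by rewrite lerXn2r ?nnegrE ?invr_ge0 ?exprn_ge0 ?mulr_ge0 ?(ltW bR) ?(ltW y0).
Qed.
End tails.

(** * Constants, and ratios of extended reals *)

Lemma ltr_abs_ratio (R : realType) (a x C : R) : 0 < a -> 0 <= x ->
  ((C * 1)%:E < `|a%:E / x%:E|)%E = (C * x < a).
Proof.
move=> a0; rewrite mulr1 le_eqVlt => /orP[/eqP <-|x0].
  by rewrite inver eqxx gt0_muley ?lte_fin // mulr0 a0 ltry.
rewrite inver gt_eqF // -EFinM abse_EFin lte_fin ger0_norm ?divr_ge0 ?ltW //.
by rewrite ltr_pdivlMr.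
Qed.

Lemma ltr_abs_rho (R : realType) d N (x : 'I_N -> 'rV[R]_d) C (u v : R) :
  0 < v -> 0 <= u -> R_infty x = u%:E -> h_infty x = v%:E ->
  (C%:E < `|rho_infty x|)%E = (C * u < 2 * v).
Proof.
move=> v0 u0 Ru hv; rewrite /rho_infty Ru hv eqe.
have [->|une] := eqVneq u 0; first by rewrite ltry mulr0 mulr_gt0.
have up : 0 < u by rewrite lt_neqAle eq_sym une.
rewrite inver (negbTE une) -!EFinM abse_EFin lte_fin ger0_norm ?divr_ge0
  ?mulr_ge0 ?ltW //.
by rewrite ltr_pdivlMr.
Qed.

Lemma ltr_abs_ratio_rho (R : realType) d N (x : 'I_N -> 'rV[R]_d) a C (u v : R) :
  0 < a -> 0 < C -> 0 < v -> 0 <= u -> R_infty x = u%:E -> h_infty x = v%:E ->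
  ((C * 1)%:E < `|a%:E / rho_infty x|)%E = (C * (2 * v) < a * u).
Proof.
move=> a0 C0 v0 u0 Ru hv; rewrite mulr1 /rho_infty Ru hv eqe.
have [->|une] := eqVneq u 0.
  rewrite invey mule0 abse0 lte_fin mulr0.
  by apply/idP/idP => h; exfalso; move: h; apply/negP; rewrite -leNgt ?mulr_ge0 // ltW.
have up : 0 < u by rewrite lt_neqAle eq_sym une.
have w0 : 0 < 2 * v / u by rewrite divr_gt0 ?mulr_gt0.
rewrite inver (negbTE une) -!EFinM inver (gt_eqF w0) -EFinM abse_EFin lte_fin.
rewrite ger0_norm; last by apply: divr_ge0; apply: ltW.
by rewrite ltr_pdivlMr // mulrA ltr_pdivrMr.
Qed.

Lemma exists_large_constant (R : realType) d (D eps : R) : 0 <= D -> 0 < eps ->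
  exists2 C, 0 < C & (1 + D / C ^+ 2) ^+ d - 1 <= eps.
Proof.
(* The three terms of [C] make it at least 1, at least [D], and at least
   [2 ^+ d * D / eps]; one factor of [C ^+ 2] is dropped. *)
move=> D0 e0; pose C := 1 + D + 2 ^+ d * D / eps.
have q0 : 0 <= 2 ^+ d * D / eps by rewrite divr_ge0 ?mulr_ge0 ?exprn_ge0 // ltW.
have C1 : 1 <= C by rewrite /C; lra.
have C0 : 0 < C by apply: lt_le_trans C1.
exists C => //.
have DC : D / C ^+ 2 <= D / C.
  by rewrite ler_wpM2l // lef_pV2 ?posrE ?exprn_gt0 // expr2 ler_peMl // ltW.
have u1 : 0 <= D / C ^+ 2 <= 1.
  apply/andP; split; first by rewrite divr_ge0 // exprn_ge0 // ltW.
  apply: le_trans DC _.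
  by rewrite ler_pdivrMr // mul1r /C; lra.
apply: le_trans (expr_1D_le d u1) _; have [u0 _] := andP u1.
apply: (@le_trans _ _ (2 ^+ d * (D / C))).
  apply: (@le_trans _ _ (2 ^+ d * (D / C ^+ 2))); first by rewrite ler_wpM2r //; lra.
  by rewrite ler_wpM2l // exprn_ge0.
rewrite mulrA ler_pdivrMr // [leRHS]mulrC -ler_pdivrMr //.
by rewrite /C; lra.
Qed.

(** The logarithmic factor absorbs the number of levels, since
    [m + kappa <= (1 + kappa) * m] and [ln N = m * ln b]. *)
Lemma exists_small_constant (R : realType) b d kappa (B eps : R) : (1 < b)%N ->
  0 <= B -> 0 < eps -> exists2 C : R, 0 < C & forall m, (0 < m)%N ->
    B * (log_scale R b d m * C) ^- (2 * d.+1) * (m + kappa)%:R ^+ d <= eps.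
Proof.
move=> b1 B0 e0; have lnb : 0 < ln (b%:R : R) by rewrite ln_gt0 // ltr1n.
pose K : R := (1 + kappa)%:R / ln b%:R.
have K0 : 0 <= K by rewrite divr_ge0 // ltW.
(* As [C >= 1], a single factor of [C ^+ (2 * d.+1)] suffices. *)
pose C := 1 + B * K ^+ d / eps.
have q0 : 0 <= B * K ^+ d / eps by rewrite divr_ge0 ?mulr_ge0 ?exprn_ge0 // ltW.
have C1 : 1 <= C by rewrite /C; lra.
have C0 : 0 < C by apply: lt_le_trans C1.
exists C; [exact: C0|move=> m m0; set lam := log_scale _ _ _ _].
have mR : 1 <= m%:R :> R by rewrite ler1n.
have lnN : ln ((b ^ m)%:R : R) = m%:R * ln b%:R.
  by rewrite natrX lnXn ?mulr_natl // ltr0n ltnW.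
have lamX : lam ^+ (2 * d.+1) = (m%:R * ln b%:R) ^+ d.
  rewrite -powR_mulrn ?powR_ge0 // /lam /log_scale -powRrM natrM divfK; last first.
    by rewrite mulf_neq0 // pnatr_eq0.
  by rewrite lnN powR_mulrn // mulr_ge0 // ltW.
rewrite exprMn lamX invfM mulrA mulrAC.
have ratio : (m + kappa)%:R <= K * (m%:R * ln b%:R) :> R.
  rewrite /K mulrCA mulrAC -mulrA divff ?gt_eqF // mulr1 -natrM ler_nat; nia.
apply: (@le_trans _ _ (B * K ^+ d / C ^+ (2 * d.+1))).
  rewrite ler_pM2r ?invr_gt0 ?exprn_gt0 // mulrAC -mulrA ler_wpM2l //.
  rewrite ler_pdivrMr; last by rewrite exprn_gt0 // mulr_gt0 // (lt_le_trans ltr01).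
  by rewrite -exprMn lerXn2r ?nnegrE // mulr_ge0 // mulr_ge0 // ltW.
rewrite ler_pdivrMr ?exprn_gt0 // [leRHS]mulrC -ler_pdivrMr //.
apply: (@le_trans _ _ C); first by rewrite /C; lra.
by rewrite ler_eXnr.
Qed.

(** * Orders in probability *)

Section asymptotics.
Context (R : realType) (b d t kappa : nat) (A : R)
  (P : forall m : nat, point_set R b d.+1 (b ^ m)) (disp : nat -> measure_display)
  (T : forall m : nat, measurableType (disp m)) (Pr : forall m : nat,
    probability (T m) R)
  (pi : forall m : nat, T m -> 'I_d.+1 * seq 'I_b -> {perm 'I_b}).
Arguments P : clear implicits.
Arguments pi : clear implicits.
Context (b1 : (1 < b)%N) (net : forall m, (t <= m)%N -> is_net t (P m))
  (owen : forall m, (t <= m)%N -> owen_permutations (Pr m) (pi m)).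

Local Notation gamma := (net_scale R b d).
Local Notation lambda := (log_scale R b d).

Lemma R_infty_scramble m w : (t < m)%N ->
  R_infty (scramble (pi m w) (P m)) = (fine (R_infty (scramble (pi m w) (P m))))%:E.
Proof.
move=> tm; rewrite fineK // R_infty_fin_num // -(exp1n m) ltn_exp2r //.
exact: leq_ltn_trans tm.
Qed.

Lemma h_infty_scramble m w :
  h_infty (scramble (pi m w) (P m)) = (fine (h_infty (scramble (pi m w) (P m))))%:E.
Proof. by rewrite fineK // h_infty_fin_num // expn_gt0 ltnW. Qed.

Lemma h_infty_order m w : (t <= m)%N ->
  ((2 * b%:R)^-1 / gamma m ^+ 2 <= fine (h_infty (scramble (pi m w) (P m))) <=
   b%:R ^+ t.+1 / gamma m ^+ 2).
Proof.
move=> tm; have g2 : 0 < gamma m ^+ 2 by rewrite exprn_gt0 // net_scale_gt0.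
have bR : 0 < b%:R :> R by rewrite ltr0n ltnW.
have b0 := ltnW b1.
apply/andP; split; rewrite -lee_fin -h_infty_scramble.
  (* The least power of [b] whose [d.+1]-th power exceeds [b ^ m]. *)
  pose q := (b ^ (m %/ d.+1).+1)%N.
  apply: le_trans (@h_infty_ge _ _ _ q _ _ _); last 2 first.
  - by rewrite expn_gt0 b0.
  - by rewrite -expnM ltn_exp2l // ltn_ceil.
  have q0 : 0 < q%:R :> R by rewrite ltr0n expn_gt0 b0.
  have p1 : 0 < 2 * q%:R :> R by rewrite mulr_gt0.
  have p2 : 0 < 2 * b%:R * gamma m ^+ 2 by rewrite mulr_gt0 // mulr_gt0.
  rewrite lee_fin -invfM lef_pV2 ?posrE //.
  rewrite -mulrA ler_pM2l // natrX exprS ler_pM2l // net_scale2_ge //.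
  by rewrite mulnC leq_trunc_div.
have hle := @scramble_h_infty_le R b d.+1 t m (P m) (pi m w) b0 (ltn0Sn d) (net tm).
apply: (le_trans hle).
rewrite lee_fin ler_pdivlMr // mulrC ler_pdivrMr ?exprn_gt0 // -exprD.
apply: net_scale2_le => //.
have := ltn_ceil (m - t) (ltn0Sn d); nia.
Qed.

Lemma R_infty_lower_order : 1 <= A -> coincidence_bound t A P -> prefix_cutoff
  t kappa P ->
  forall eps, 0 < eps -> exists2 C : R, 0 < C & forall m, (t < m)%N ->
  (Pr m [set w | (C * fine (R_infty (scramble (pi m w) (P m))) <
     (gamma m ^+ 3)^-1 / lambda m)%R] <= eps%:E)%E.
Proof.
move=> A1 coin cut eps e0.
pose B := A * (2 * b%:R ^+ 2) ^+ d.+1 * b%:R ^+ kappa * b%:R ^+ (2 * d.+1).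
have B0 : 0 <= B.
  by rewrite !mulr_ge0 ?exprn_ge0 ?mulr_ge0 ?exprn_ge0 ?ler0n // (le_trans ler01).
have [C C0 hC] := exists_small_constant d kappa b1 B0 e0.
exists C => // m tm; have m0 : (0 < m)%N by apply: leq_ltn_trans tm.
have l0 := log_scale_gt0 R d b1 m0; have g0 := net_scale_gt0 R d b1 m.
pose y := (gamma m ^+ 3)^-1 / lambda m / C.
have y0 : 0 < y by rewrite !divr_gt0 // invr_gt0 exprn_gt0.
have -> : [set w | C * fine (R_infty (scramble (pi m w) (P m))) <
     (gamma m ^+ 3)^-1 / lambda m] =
   [set w | fine (R_infty (scramble (pi m w) (P m))) < y].
  have yE u : (u < y) = (C * u < (gamma m ^+ 3)^-1 / lambda m).
    by rewrite /y ltr_pdivlMr // mulrC.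
  by apply/seteqP; split=> w /=; rewrite yE.
apply: le_trans (R_infty_small_tail b1 (owen (ltnW tm)) A1 (ltnW tm) m0 coin cut y0) _.
rewrite lee_fin; apply: le_trans (hC m m0).
rewrite le_eqVlt; apply/orP; left; apply/eqP; congr (_ * _ * _).
rewrite -exprVn; congr (_ ^+ _); rewrite /y.
by field; rewrite !gt_eqF.
Qed.

Lemma R_infty_upper_order eps : 0 < eps -> exists2 C : R, 0 < C & forall m, (t < m)%N ->
  (Pr m [set w | (C / gamma m ^+ 3 < fine (R_infty (scramble (pi m w) (P m))))%R] <=
   eps%:E)%E.
Proof.
move=> e0; pose D : R := 4 * b%:R ^+ 2 * b%:R ^+ (t + 2) ^+ 3.
have D0 : 0 <= D by rewrite !mulr_ge0 // ?exprn_ge0.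
have [C C0 hC] := exists_large_constant d.+1 D0 e0.
exists C => // m tm; have g0 := net_scale_gt0 R d b1 m.
have y0 : 0 < C / gamma m ^+ 3 by rewrite divr_gt0 // exprn_gt0.
apply: le_trans (R_infty_large_tail b1 (owen (ltnW tm)) (net (ltnW tm)) tm y0) _.
by rewrite lee_fin divfK ?gt_eqF ?exprn_gt0.
Qed.

End asymptotics.

Theorem corollary4p12 (R : realType) (b d t : nat)
  (hb : (2 <= b)%N) (hd : (1 <= d)%N) :
  exists c1 c2 : R, [/\ 0 < c1, 0 < c2 &
  forall (P : forall m : nat, point_set R b d (b ^ m))
    (A : R) (kappa : nat)
    (disp : nat -> measure_display)
    (T : forall m : nat, measurableType (disp m))
    (Pr : forall m : nat, probability (T m) R)
    (pi : forall m : nat, T m -> 'I_d * seq 'I_b -> {perm 'I_b}),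
  (forall m, (t <= m)%N -> is_net t (P m)) ->
  1 <= A ->
  coincidence_bound t A P ->
  prefix_cutoff t kappa P ->
  (forall m, (t <= m)%N -> owen_permutations (Pr m) (pi m)) ->
  let N (m : nat) : R := (b ^ m)%:R in
  let Pt (m : nat) (w : T m) := scramble (pi m w) (P m) in
  [/\ bigOmega_P Pr (fun m w => R_infty (Pt m w))
        (fun m => N m `^ (- (3 / (2 * d%:R))) *
                  ln (N m) `^ (- ((d%:R - 1) / (2 * d%:R)))),
      bigO_P Pr (fun m w => R_infty (Pt m w))
        (fun m => N m `^ (- (3 / (2 * d%:R)))),
      forall (m : nat) (w : T m), (t <= m)%N -> (1 <= m)%N ->
        ((c1 * N m `^ (- (1 / d%:R)))%:E <= h_infty (Pt m w))%E /\
        (h_infty (Pt m w) <= (c2 * N m `^ (- (1 / d%:R)))%:E)%E,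
      bigOmega_P Pr (fun m w => rho_infty (Pt m w))
        (fun m => N m `^ (1 / (2 * d%:R)))
    & bigO_P Pr (fun m w => rho_infty (Pt m w))
        (fun m => N m `^ (1 / (2 * d%:R)) *
                  ln (N m) `^ ((d%:R - 1) / (2 * d%:R)))]].
Proof.
case: d hd => // d _.
have bR : 0 < b%:R :> R by rewrite ltr0n ltnW.
have c10 : 0 < (2 * b%:R)^-1 :> R by rewrite invr_gt0 mulr_gt0.
have c20 : 0 < b%:R ^+ t.+1 :> R by rewrite exprn_gt0.
exists (2 * b%:R)^-1, (b%:R ^+ t.+1);
  split=> // P A kappa disp T Pr pi net A1 coin cut owen N Pt.
pose g : nat -> R := net_scale R b d; pose l : nat -> R := log_scale R b d.
have g0 m : 0 < g m by apply: net_scale_gt0.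
have g3 m : 0 < g m ^+ 3 by rewrite exprn_gt0.
have l0 m : (t < m)%N -> 0 < l m.
  by move=> tm; apply: log_scale_gt0 => //; apply: leq_ltn_trans tm.
have N3 m : N m `^ (- (3 / (2 * d.+1%:R))) = (g m ^+ 3)^-1 by apply: powR_net_scaleN.
have N1 m : N m `^ (- (1 / d.+1%:R)) = (g m ^+ 2)^-1.
  by rewrite -powR_net_scaleN; congr (_ `^ (- _));
    rewrite invfM mulrA divff // pnatr_eq0.
have d1 : d.+1%:R - 1 = d%:R :> R by rewrite -natr1 addrK.
have lnN m : ln (N m) `^ ((d.+1%:R - 1) / (2 * d.+1%:R)) = l m by rewrite d1.
have RE m w (tm : (t < m)%N) := @R_infty_scramble R b d t P disp T pi hb m w tm.
have hE m w := @h_infty_scramble R b d P disp T pi hb m w.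
have hO m w tm := @h_infty_order R b d t P disp T pi hb net m w tm.
have R0 m w : 0 <= fine (R_infty (Pt m w)) by rewrite fine_ge0 // R_infty_ge0.
have H0 m w : (t < m)%N -> 0 < fine (h_infty (Pt m w)).
  move=> tm; have /andP[h _] := hO m w (ltnW tm); apply: lt_le_trans h.
  by rewrite divr_gt0 // exprn_gt0.
have low := R_infty_lower_order hb owen A1 coin cut.
have up := R_infty_upper_order hb net owen.
have N_gt1 m : (t < m)%N -> (1 < b ^ m)%N.
  by move=> tm; rewrite -(exp1n m) ltn_exp2r //; apply: leq_ltn_trans tm.
have mR m : (t < m)%N -> measurable_fun setT (fun w => fine (R_infty (Pt m w))).
  by move=> tm; exact: (measurable_R_infty (P m) (owen m (ltnW tm)) hb (N_gt1 m tm)).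
have mh m : (t < m)%N -> measurable_fun setT (fun w => fine (h_infty (Pt m w))).
  by move=> tm; exact: (measurable_h_infty (P m) (owen m (ltnW tm)) hb (N_gt1 m tm)).
have mM m (c : R) f : measurable_fun [set: T m] f -> measurable_fun setT (fun w
  => c * f w).
  by move=> mf; apply: measurable_funM => //; apply: measurable_cst.
split.
- move=> eps e0; have [C C0 hC] := low eps e0; exists C; split=> //;
    exists t.+1 => m tm.
  apply: le_trans (hC m tm); rewrite le_eqVlt; apply/orP; left; apply/eqP;
    congr (Pr m _).
  apply/seteqP; split=> w /=; rewrite N3 powRN lnN (RE m w tm) ltr_abs_ratio
    ?divr_gt0 ?invr_gt0 ?l0 ?R0 //.
- move=> eps e0; have [C C0 hC] := up eps e0; exists C; split=> //; exists t.+1 => m tm.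
  apply: le_trans (hC m tm); rewrite le_eqVlt; apply/orP; left; apply/eqP;
    congr (Pr m _).
  by apply/seteqP; split=> w /=; rewrite N3 (RE m w tm) abse_EFin lte_fin ger0_norm ?R0.
- move=> m w tm _; rewrite N1 (hE m w) !lee_fin.
  by have /andP[] := hO m w tm.
- move=> eps e0; have [C C0 hC] := up eps e0.
  (* [2 * h] is at least [b^-1 / g m ^+ 2]. *)
  pose C' := C * b%:R; have C'0 : 0 < C' by rewrite mulr_gt0.
  exists C'; split=> //; exists t.+1 => m tm.
  apply: le_trans (hC m tm).
  have -> : [set w | ((C' * 1)%:E < `|(N m `^ (1 / (2 * d.+1%:R)))%:E /
    rho_infty (Pt m w)|)%E] =
    [set w | C' * 2 * fine (h_infty (Pt m w)) < g m * fine (R_infty (Pt m w))].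
    by apply/seteqP; split=> w /=;
      rewrite (@ltr_abs_ratio_rho _ _ _ _ (g m) _ _ _ (g0 m) C'0 (H0 m w tm)
        (R0 m w) (RE m w tm) (hE m w)) mulrA.
  apply: le_measure; rewrite ?inE.
  + by apply: measurable_lt_set; apply: mM; [exact: mh|exact: mR].
  + by apply: measurable_lt_set; [exact: measurable_cst|exact: mR].
  move=> w /= lt; have /andP[hlow _] := hO m w (ltnW tm).
  rewrite -(ltr_pM2l (g0 m)); apply: le_lt_trans lt.
  apply: (@le_trans _ _ (C' * 2 * ((2 * b%:R)^-1 / g m ^+ 2))); last first.
    by rewrite ler_wpM2l // mulr_ge0 // ltW.
  rewrite le_eqVlt; apply/orP; left; apply/eqP; rewrite /C' -/(g m).
  by field; rewrite !gt_eqF.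
- move=> eps e0; have [C C0 hC] := low eps e0.
  (* [2 * h] is at most [2 * b ^+ t.+1 / g m ^+ 2]. *)
  pose C' := 2 * b%:R ^+ t.+1 * C; have C'0 : 0 < C' by rewrite !mulr_gt0.
  exists C'; split=> //; exists t.+1 => m tm.
  apply: le_trans (hC m tm); have lm := l0 m tm.
  have -> : [set w | ((C' * (N m `^ (1 / (2 * d.+1%:R)) *
       ln (N m) `^ ((d.+1%:R - 1) / (2 * d.+1%:R))))%:E < `|rho_infty (Pt m w)|)%E] =
    [set w | C' * (g m * l m) * fine (R_infty (Pt m w)) < 2 * fine (h_infty (Pt m w))].
    by apply/seteqP; split=> w /=; rewrite lnN
      (ltr_abs_rho _ (H0 m w tm) (R0 m w) (RE m w tm) (hE m w)).
  apply: le_measure; rewrite ?inE.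
  + by apply: measurable_lt_set; apply: mM; [exact: mR|exact: mh].
  + by apply: measurable_lt_set; [apply: mM; exact: mR|exact: measurable_cst].
  move=> w /= lt; have /andP[_ hup] := hO m w (ltnW tm).
  have k0 : 0 < 2 * b%:R ^+ t.+1 * (g m * l m) by rewrite !mulr_gt0.
  rewrite -(ltr_pM2l k0).
  have -> : 2 * b%:R ^+ t.+1 * (g m * l m) * (C * fine (R_infty (Pt m w))) =
      C' * (g m * l m) * fine (R_infty (Pt m w)) by rewrite /C'; ring.
  apply: lt_le_trans lt _.
  apply: (@le_trans _ _ (2 * (b%:R ^+ t.+1 / g m ^+ 2))); first by rewrite ler_pM2l.
  rewrite le_eqVlt; apply/orP; left; apply/eqP.
  by rewrite -/(g m) -/(l m); field; rewrite !gt_eqF.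
Qed.
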